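(* Let $\varphi:C\to C'$ be a (possibly ramified) covering of smooth projective connected complex curves of genus $>1$. Let $X'$ be a nonzero rational vector field on $C'$, let $\alpha'=(X')^{-1}$ be the rational differential on $C'$ inverse to $X'$, and set $\alpha=\varphi^*(\alpha')$ and $X=\alpha^{-1}$, a nonzero rational vector field on $C$. Let $D'=\sum_{P'\in C'}\delta'_{P'}P'$ be an effective divisor on $C'$, and set $D=\varphi^{-1}(D')=\sum_{P\in C}\big(\delta'_{\varphi(P)}\nu_P+(1-\nu_P)\big)P$, where $\nu_P$ is the ramification index of $\varphi$ at $P$; then $D$ is an effective divisor on $C$. There exists a morphism $\varphi^*_{\mathrm{rat}}:B_{X'}^{C',\mathrm{rat}}\to B_X^{C,\mathrm{rat}}$ of complete filtered algebras. It induces morphisms of complete filtered algebras $\varphi^*_{\mathrm{pseudo}}:B_{X'}^{(C')}\to B_X^{(C)}$ and $\varphi^*_{\mathrm{pseudo}}:B_{X'}^{(C',D')}\to B_X^{(C,D)}$, quantizing the morphisms $\varphi^*_{\mathrm{class}}:A^{(C')}\to A^{(C)}$ and $\varphi^*_{\mathrm{class}}:A^{(C',D')}\to A^{(C,D)}$ respectively (i.e. their associated graded maps are identified with the maps $\varphi^*_{\mathrm{class}}$).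
   Context: **Pseudodifferential operators.** For a commutative ring $R$ with unit and a derivation $\partial$, $\Psi\mathrm{DO}(R,\partial)$ is the algebra of formal sums $\sum_{i\in\mathbb Z}a_iD_\partial^i$ ($a_i\in R$, $a_i=0$ for $i$ large), with product $(\sum_i a_iD_\partial^i)(\sum_j b_jD_\partial^j)=\sum_k\big(\sum_{i+j\ge k}\binom{i}{i+j-k}a_i\,\partial^{i+j-k}(b_j)\big)D_\partial^k$. $\Psi\mathrm{DO}(R,\partial)_{\le n}$ is the subspace of sums with $a_i=0$ for $i>n$. If $f\in R^\times$ and $\partial'=f\partial$, there is an isomorphism $i_{\partial,\partial'}:\Psi\mathrm{DO}(R,\partial)\to\Psi\mathrm{DO}(R,\partial')$, $\sum a_iD_\partial^i\mapsto\sum a_i(f^{-1}D_{\partial'})^i$. **The algebras $B$.** For a curve $C$ with function field $\mathbb C(C)$ and a nonzero rational vector field $X$ on $C$, $B_X^{C,\mathrm{rat}}=\Psi\mathrm{DO}(\mathbb C(C),X)_{\le0}$, filtered by the $\Psi\mathrm{DO}(\mathbb C(C),X)_{\le -i}$, $i\ge 0$. For $P\in C$ with local coordinate $z_P$, let $\mathcal K_P=\mathbb C((z_P))\supset\mathcal O_P=\mathbb C[[z_P]]$ be the completed local field and ring, $\Psi\mathrm{DO}(\mathcal K_P,z_P)=\Psi\mathrm{DO}(\mathcal K_P,\partial/\partial z_P)$, and for an integer $\delta\ge 0$ let $\Psi\mathrm{DO}(\mathcal O_P,z_P)^{(\delta)}_{\le0}=\Psi\mathrm{DO}(\mathcal O_P,z_P^{\delta}\partial/\partial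 z_P)_{\le0}$, viewed inside $\Psi\mathrm{DO}(\mathcal K_P,z_P)_{\le0}$ by change of derivation. Laurent expansion at $P$, followed by the change of derivation from $X=X(z_P)\partial/\partial z_P$ to $\partial/\partial z_P$, gives $L_P^{z_P}:B_X^{C,\mathrm{rat}}\to\Psi\mathrm{DO}(\mathcal K_P,z_P)_{\le0}$. For an effective divisor $D=\sum\delta_PP$, $B_X^{(C,D)}=\big(\prod_PL_P^{z_P}\big)^{-1}\big(\prod_P\Psi\mathrm{DO}(\mathcal O_P,z_P)^{(\delta_P)}_{\le0}\big)$ (independent of the choice of the $z_P$), with the filtration induced from $B_X^{C,\mathrm{rat}}$; $B_X^{(C)}=B_X^{(C,0)}$. **Classical algebras.** $A^{(C,D)}=\oplus_{i\ge0}H^0(C,K(D)^{\otimes i})$, where $K$ is the canonical bundle of $C$; $A^{(C)}=A^{(C,0)}$. It is a Poisson algebra with bracket $\{\omega,\omega'\}=i'\omega'\nabla^\beta(\omega)-i\,\omega\nabla^\beta(\omega')$ for $\omega,\omega'$ of degrees $i,i'$, where $\beta$ is any nonzero rational differential and $\nabla^\beta(\omega)=\beta^id(\omega/\beta^i)$. The maps $\varphi^*_{\mathrm{class}}$ are given by pull-back of (rational) $i$-differentials along $\varphi$; they are morphisms of graded algebras and of Poisson algebras. **Identification of $\mathrm{gr}$.** $\mathrm{gr}(B_X^{(C,D)})\simeq A^{(C,D)}$ sends the class of $\sum_{j\ge i}a_j(D_X)^{-j}$ in degree $i$ to $a_i\alpha^i$, where $\alpha=X^{-1}$ is the rational differential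 inverse to $X$.
   Formalization: D is not always effective (D'=0 with φ ramified gives coefficients 1−ν_P<0); it is shown to be a divisor, effective iff δ'_{φ(P)}>0 at every ramified P, and the claims on B^{(C',D')}→B^{(C,D)} and A^{(C',D')}→A^{(C,D)} are made when D is effective. *)

(* Defs.v *)
From HB Require Import structures.
From mathcomp Require Import all_boot all_order all_algebra.
From mathcomp Require Import boolp classical_sets functions cardinality fsbigop.
From mathcomp Require Import reals complex mpoly.

Set Implicit Arguments.
Unset Strict Implicit.
Unset Printing Implicit Defensive.

Import Order.TTheory GRing.Theory Num.Theory.
Local Open Scope classical_set_scope.
Local Open Scope ring_scope.

(** * Formal Laurent series F((z)) *)

Record laurent (F : fieldType) := Laurent {
  lcoef :> int -> F;
  lcoef_bounded : exists m : int, forall k, k < m -> lcoef k = 0 }.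

HB.instance Definition _ (F : fieldType) := gen_eqMixin (laurent F).
HB.instance Definition _ (F : fieldType) := gen_choiceMixin (laurent F).

Section LaurentRing.
Variable F : fieldType.
Implicit Types f g h : laurent F.

Lemma laurentP f g : (forall k, f k = g k) -> f = g.
Proof.
case: f g => [f fb] [g gb] /= fg; have {}fg : f = g by apply/funext.
by rewrite fg in fb *; congr Laurent; apply: Prop_irrelevance.
Qed.

Lemma lcoef_bounded2 f g :
  exists m : int, forall k, k < m -> f k = 0 /\ g k = 0.
Proof.
have [m fm] := lcoef_bounded f; have [n gn] := lcoef_bounded g.
exists (Order.min m n) => k; rewrite lt_min => /andP[km kn].
by rewrite fm// gn.
Qed.

Fact laurent_mono_bounded (c : F) (n : int) :
  exists m : int, forall k, k < m -> (if k == n then c else 0) = 0.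
Proof. by exists n => k; case: eqP => // ->; rewrite ltxx. Qed.
Definition laurent_mono c n := Laurent (laurent_mono_bounded c n).

Fact laurent_add_bounded f g :
  exists m : int, forall k, k < m -> f k + g k = 0.
Proof.
have [m fg] := lcoef_bounded2 f g.
by exists m => k /fg[-> ->]; rewrite addr0.
Qed.
Definition laurent_add f g := Laurent (laurent_add_bounded f g).

Fact laurent_opp_bounded f : exists m : int, forall k, k < m -> - f k = 0.
Proof.
by have [m fm] := lcoef_bounded f; exists m => k /fm->; rewrite oppr0.
Qed.
Definition laurent_opp f := Laurent (laurent_opp_bounded f).

Definition laurent_conv f g (k : int) : F :=
  \sum_(i \in [set: int]) f i * g (k - i).

Lemma laurent_conv0 f g (m n k : int) :
  (forall i, i < m -> f i = 0) -> (forall j, j < n -> g j = 0) ->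
  k < m + n -> laurent_conv f g k = 0.
Proof.
move=> fm gn kmn; apply: fsbig1 => i _.
have [/fm->|mi] := ltP i m; first by rewrite mul0r.
by rewrite gn ?mulr0// ltrBlDr (lt_le_trans kmn)// addrC lerD2l.
Qed.

Fact laurent_mul_bounded f g :
  exists m : int, forall k, k < m -> laurent_conv f g k = 0.
Proof.
have [m fm] := lcoef_bounded f; have [n gn] := lcoef_bounded g.
by exists (m + n) => k; apply: laurent_conv0.
Qed.
Definition laurent_mul f g := Laurent (laurent_mul_bounded f g).

Lemma laurent_mulE f g (m n : int) (k : nat) :
  (forall i, i < m -> f i = 0) -> (forall j, j < n -> g j = 0) ->
  laurent_mul f g (m + n + k%:Z) =
    \sum_(i < k.+1) f (m + i%:Z) * g (n + (k - i)%N%:Z).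
Proof.
move=> fm gn; rewrite /= /laurent_conv.
rewrite (fsbigE [seq m + i%:Z | i <- index_iota 0 k.+1]); first last.
- move=> i _; apply: contraNeq => fg0.
  have mi : m <= i.
    by rewrite leNgt; apply: contraNN fg0 => /fm->; rewrite mul0r.
  have ik : i <= m + k%:Z.
    rewrite leNgt; apply: contraNN fg0 => ik; apply/eqP.
    by rewrite gn ?mulr0// ltrBlDr -addrA addrCA ltrD2l.
  apply/mapP; exists `|i - m|%N; last by rewrite gez0_abs ?subr_ge0// subrKC.
  by rewrite mem_index_iota ltnS /= -lez_nat gez0_abs ?subr_ge0// lerBlDl.
- by [].
- by rewrite map_inj_uniq ?iota_uniq// => a b /addrI[].
rewrite big_map.
under eq_bigl do rewrite in_setT.
rewrite big_mkord; apply: eq_bigr => i _.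
have ik : (i <= k)%N by rewrite -ltnS.
congr (_ * g _).
by rewrite -subzn// opprD addrACA [m + n - m]addrAC subrr add0r.
Qed.

(* The ring laws are transported from {poly F} by truncation. *)
Let trunc (m : int) K f : {poly F} := \poly_(i < K) f (m + i%:Z).

Lemma laurent_mul_trunc f g (m n : int) K k :
  (forall i, i < m -> f i = 0) -> (forall j, j < n -> g j = 0) ->
  (k < K)%N ->
  laurent_mul f g (m + n + k%:Z) = (trunc m K f * trunc n K g)`_k.
Proof.
move=> fm gn kK; rewrite laurent_mulE// coefM.
apply: eq_bigr => i _; rewrite !coef_poly (leq_ltn_trans (leq_subr _ _) kK).
by rewrite (leq_trans (ltn_ord i) kK).
Qed.

Lemma laurent_ind_coef f g (m : int) :
  (forall k, k < m -> f k = 0) -> (forall k, k < m -> g k = 0) ->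
  (forall k : nat, f (m + k%:Z) = g (m + k%:Z)) -> f = g.
Proof.
move=> fm gm fg; apply: laurentP => k.
have [km|mk] := ltP k m; first by rewrite fm// gm.
by have := fg `|k - m|%N; rewrite gez0_abs ?subr_ge0// subrKC.
Qed.

Lemma laurent_addA : associative laurent_add.
Proof. by move=> f g h; apply: laurentP => k /=; rewrite addrA. Qed.

Lemma laurent_addC : commutative laurent_add.
Proof. by move=> f g; apply: laurentP => k /=; rewrite addrC. Qed.

Lemma laurent_add0 : left_id (laurent_mono 0 0) laurent_add.
Proof. by move=> f; apply: laurentP => k /=; rewrite if_same add0r. Qed.

Lemma laurent_addN : left_inverse (laurent_mono 0 0) laurent_opp laurent_add.
Proof. by move=> f; apply: laurentP => k /=; rewrite if_same addNr. Qed.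

Lemma laurent_mulA : associative laurent_mul.
Proof.
move=> f g h; have [m fm] := lcoef_bounded f; have [n gn] := lcoef_bounded g.
have [p hp] := lcoef_bounded h.
have fgm k : k < m + n -> laurent_mul f g k = 0 by apply: laurent_conv0.
have ghn k : k < n + p -> laurent_mul g h k = 0 by apply: laurent_conv0.
apply: (@laurent_ind_coef _ _ (m + n + p)) => k.
- by rewrite -addrA; apply: laurent_conv0.
- exact: laurent_conv0.
rewrite (laurent_mul_trunc fgm hp (ltnSn k)) -{1}[m + n + p]addrA.
rewrite (laurent_mul_trunc fm ghn (ltnSn k)).
transitivity ((trunc m k.+1 f * trunc n k.+1 g * trunc p k.+1 h)`_k).
  rewrite -mulrA !coefM; apply: eq_bigr => i _; congr (_ * _).
  rewrite coef_poly ltnS leq_subr.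
  by rewrite (laurent_mul_trunc (K := k.+1) gn hp)// ltnS leq_subr.
rewrite !coefM; apply: eq_bigr => i _; congr (_ * _).
by rewrite coef_poly ltn_ord (laurent_mul_trunc (K := k.+1) fm gn).
Qed.

Lemma laurent_mulC : commutative laurent_mul.
Proof.
move=> f g; have [m fm] := lcoef_bounded f; have [n gn] := lcoef_bounded g.
apply: (@laurent_ind_coef _ _ (m + n)) => k.
- exact: laurent_conv0.
- by rewrite addrC; apply: laurent_conv0.
rewrite (laurent_mul_trunc fm gn (ltnSn k)) [m + n]addrC.
by rewrite (laurent_mul_trunc gn fm (ltnSn k)) mulrC.
Qed.

Lemma laurent_mul1 : left_id (laurent_mono 1 0) laurent_mul.
Proof.
move=> f; apply: laurentP => k /=; rewrite /laurent_conv.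
rewrite (fsbigE [:: 0]) //; last first.
  by move=> i _ /=; rewrite inE; case: eqP => // _; rewrite mul0r.
by rewrite big_cons big_nil in_setT /= mul1r !addr0.
Qed.

Lemma laurent_mulDl : left_distributive laurent_mul laurent_add.
Proof.
move=> f g h; have [m fgm] := lcoef_bounded2 f g.
have [p hp] := lcoef_bounded h.
have fm k : k < m -> f k = 0 by case/fgm.
have gm k : k < m -> g k = 0 by case/fgm.
have sm k : k < m -> laurent_add f g k = 0.
  by move=> /fgm /= [-> ->]; rewrite addr0.
apply: (@laurent_ind_coef _ _ (m + p)) => k.
- exact: laurent_conv0.
- by move=> km /=; rewrite !(@laurent_conv0 _ _ m p)// addr0.
rewrite (laurent_mul_trunc sm hp (ltnSn k)) [RHS]/=.
rewrite -[laurent_conv f h _]/(laurent_mul f h _).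
rewrite -[laurent_conv g h _]/(laurent_mul g h _).
rewrite (laurent_mul_trunc fm hp (ltnSn k)) (laurent_mul_trunc gm hp (ltnSn k)).
rewrite -coefD -mulrDl.
suff -> : trunc m k.+1 (laurent_add f g) = trunc m k.+1 f + trunc m k.+1 g.
  by [].
by apply/polyP => i; rewrite coefD !coef_poly; case: ifP; rewrite ?addr0.
Qed.

Lemma laurent_1neq0 : laurent_mono 1 0 != laurent_mono 0 0.
Proof.
apply/eqP => /(congr1 (fun f : laurent F => f 0)) /= /eqP.
by rewrite oner_eq0.
Qed.

End LaurentRing.

HB.instance Definition _ (F : fieldType) := GRing.isZmodule.Build (laurent F)
  (@laurent_addA F) (@laurent_addC F) (@laurent_add0 F) (@laurent_addN F).
HB.instance Definition _ (F : fieldType) :=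
  GRing.Zmodule_isComNzRing.Build (laurent F)
    (@laurent_mulA F) (@laurent_mulC F) (@laurent_mul1 F) (@laurent_mulDl F)
    (@laurent_1neq0 F).

Section LaurentInverse.
Variable F : fieldType.
Implicit Types f g : laurent F.

Definition laurent_unit : pred (laurent F) :=
  fun f => `[< exists g, g * f = 1 >].
Definition laurent_inv f : laurent F := xget f [set g | g * f = 1].

Lemma laurent_mulVr :
  {in laurent_unit, left_inverse 1 laurent_inv (@GRing.mul (laurent F))}.
Proof. move=> f /asboolP[g gf].
by apply: (@xgetPex _ f [set h | h * f = 1]); exists g. Qed.

Lemma laurent_unitPl f g : g * f = 1 -> laurent_unit f.
Proof. by move=> gf; apply/asboolP; exists g. Qed.

Lemma laurent_inv_out : {in [predC laurent_unit], laurent_inv =1 id}.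
Proof.
move=> f /asboolPn nf; rewrite /laurent_inv; case: xgetP => // g _ gf.
by case: nf; exists g.
Qed.

End LaurentInverse.

HB.instance Definition _ (F : fieldType) :=
  GRing.ComNzRing_hasMulInverse.Build (laurent F)
    (@laurent_mulVr F) (@laurent_unitPl F) (@laurent_inv_out F).

Definition power_series (F : fieldType) : set (laurent F) :=
  [set f | forall k : int, k < 0 -> f k = 0].

(** * Derivations *)

Record derivation (R : comNzRingType) := Derivation {
  der :> R -> R;
  derD : {morph der : x y / x + y};
  derM : forall x y, der (x * y) = der x * y + x * der y }.

Section Derivations.
Variable R : comNzRingType.

Fact scale_derD (f : R) (d : derivation R) :
  {morph (fun x => f * d x) : x y / x + y}.
Proof. by move=> x y; rewrite derD mulrDr. Qed.
Fact scale_derM (f : R) (d : derivation R) x y :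
  f * d (x * y) = f * d x * y + x * (f * d y).
Proof. by rewrite derM mulrDr mulrA [x * (f * _)]mulrCA. Qed.
Definition scale_der f d := Derivation (scale_derD f d) (scale_derM f d).

Fact zero_derD : {morph (fun=> 0 : R) : x y / (x : R) + y}.
Proof. by move=> x y; rewrite addr0. Qed.
Fact zero_derM (x y : R) : 0 = 0 * y + x * 0.
Proof. by rewrite mul0r mulr0 addr0. Qed.
Definition zero_der := Derivation zero_derD zero_derM.

Lemma der0 (d : derivation R) : d 0 = 0.
Proof. by apply: (addrI (d 0)); rewrite -derD !addr0. Qed.

Lemma iter_der0 (d : derivation R) m : iter m d 0 = 0.
Proof. by elim: m => //= m ->; rewrite der0. Qed.

End Derivations.

Section LaurentDerivation.
Variable F : fieldType.
Implicit Types f g : laurent F.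

Fact laurent_deriv_bounded f :
  exists m : int, forall k, k < m -> f (k + 1) *~ (k + 1) = 0.
Proof.
have [m fm] := lcoef_bounded f; exists (m - 1) => k km.
by rewrite fm ?mul0rz// -ltrBrDr.
Qed.
Definition laurent_deriv f := Laurent (laurent_deriv_bounded f).

Fact laurent_derivD : {morph laurent_deriv : f g / f + g}.
Proof. by move=> f g; apply: laurentP => k /=; rewrite mulrzDl. Qed.

Fact laurent_derivM f g :
  laurent_deriv (f * g) = laurent_deriv f * g + f * laurent_deriv g.
Proof.
have [m fm] := lcoef_bounded f; have [n gn] := lcoef_bounded g.
have dfm k : k < m - 1 -> laurent_deriv f k = 0.
  by move=> km /=; rewrite fm ?mul0rz// -ltrBrDr.
have dgn k : k < n - 1 -> laurent_deriv g k = 0.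
  by move=> kn /=; rewrite gn ?mul0rz// -ltrBrDr.
apply: (@laurent_ind_coef _ _ _ (m + n - 1)) => k.
- move=> km; rewrite [LHS]/= (@laurent_conv0 _ _ _ m n) ?mul0rz//.
  by rewrite -ltrBrDr.
- move=> km; rewrite [LHS]/= (@laurent_conv0 _ _ _ (m - 1) n) 1?addrAC//.
  by rewrite (@laurent_conv0 _ _ _ m (n - 1)) ?addr0// addrA.
have -> : laurent_deriv (f * g) (m + n - 1 + k%:Z)
    = (f * g) (m + n + k%:Z) *~ (m + n + k%:Z).
  by rewrite /= addrAC subrK.
transitivity (laurent_mul (laurent_deriv f) g (m - 1 + n + k%:Z)
    + laurent_mul f (laurent_deriv g) (m + (n - 1) + k%:Z)); last first.
  by congr (_ + _); congr lcoef; rewrite ?addrA// [m - 1 + n]addrAC.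
rewrite [(f * g) _]laurent_mulE// !laurent_mulE// mulrz_suml -big_split.
apply: eq_bigr => i _ /=.
have subK (x y : int) : x - 1 + y + 1 = x + y by rewrite addrAC subrK.
rewrite !subK.
rewrite mulrzAl mulrzAr -mulrzDr; congr (_ *~ _).
have ik : (i <= k)%N by rewrite -ltnS.
by rewrite -subzn// addrACA subrKC.
Qed.

Definition ddz := Derivation laurent_derivD laurent_derivM.

End LaurentDerivation.

(** * Pseudodifferential operators *)

(* The derivation is an index of the type: the product depends on it. *)
Record psido (R : comNzRingType) (d : derivation R) := Psido {
  pcoef : int -> R;
  pcoef_bounded : exists N : int, forall i, N < i -> pcoef i = 0 }.

(* The binomial coefficient i (i - 1) ... (i - m + 1) / m! for i in Z *)
Definition binz (i : int) (m : nat) : int :=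
  match i with
  | Posz n => 'C(n, m)%:Z
  | Negz n => (-1) ^+ m * 'C(n + m, m)%:Z
  end.

Section Psido.
Variables (R : comNzRingType) (d : derivation R).
Implicit Types a b : psido d.

Lemma psidoP a b : (forall i, pcoef a i = pcoef b i) -> a = b.
Proof.
case: a b => [a ab] [b bb] /= e; have {}e : a = b by apply/funext.
by rewrite e in ab *; congr Psido; apply: Prop_irrelevance.
Qed.

Definition order_le (n : int) : set (psido d) :=
  [set a | forall i, n < i -> pcoef a i = 0].

Fact psido_mono_bounded (r : R) (n : int) :
  exists N : int, forall i, N < i -> (if i == n then r else 0) = 0.
Proof. by exists n => i; case: eqP => // ->; rewrite ltxx. Qed.
Definition psido_mono r n : psido d := Psido d (psido_mono_bounded r n).

Fact psido_add_bounded a b :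
  exists N : int, forall i, N < i -> pcoef a i + pcoef b i = 0.
Proof.
have [M aM] := pcoef_bounded a; have [N bN] := pcoef_bounded b.
exists (Order.max M N) => i; rewrite gt_max => /andP[/aM-> /bN->].
by rewrite addr0.
Qed.
Definition psido_add a b : psido d := Psido d (psido_add_bounded a b).

Fact psido_scale_bounded (r : R) a :
  exists N : int, forall i, N < i -> r * pcoef a i = 0.
Proof.
by have [N aN] := pcoef_bounded a; exists N => i /aN->; rewrite mulr0.
Qed.
Definition psido_scale r a : psido d := Psido d (psido_scale_bounded r a).

Definition psido_mul_coef a b (k : int) : R :=
  \sum_(ij \in [set ij : int * int | k <= ij.1 + ij.2])
    let m := absz (ij.1 + ij.2 - k)%R in
    pcoef a ij.1 * iter m d (pcoef b ij.2) *~ binz ij.1 m.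

Fact psido_mul_bounded a b :
  exists N : int, forall k, N < k -> psido_mul_coef a b k = 0.
Proof.
have [M aM] := pcoef_bounded a; have [N bN] := pcoef_bounded b.
exists (M + N) => k MNk; apply: fsbig1 => -[i j] /= kij.
have [/aM->|iM] := ltP M i; first by rewrite mul0r mul0rz.
rewrite (bN j) ?iter_der0 ?mulr0 ?mul0rz//.
by have := lt_le_trans MNk (le_trans kij (lerD iM (lexx j))); rewrite ltrD2l.
Qed.
Definition psido_mul a b : psido d := Psido d (psido_mul_bounded a b).

Definition psido_one : psido d := psido_mono 1 0.

End Psido.
Arguments order_le {R} d n.
Arguments psido_mono {R} d r n.
Arguments psido_one {R} d.

Fact psido_map_bounded (R S : comNzRingType) (e : {rmorphism R -> S})
    (d : derivation R) (a : psido d) :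
  exists N : int, forall i, N < i -> e (pcoef a i) = 0.
Proof.
by have [N aN] := pcoef_bounded a; exists N => i /aN->; rewrite rmorph0.
Qed.
Definition psido_map (R S : comNzRingType) (e : {rmorphism R -> S})
    (d : derivation R) (d' : derivation S) (a : psido d) : psido d' :=
  Psido d' (psido_map_bounded e a).

Section ChangeOfDerivation.
Variables (R : comUnitRingType) (f : R) (d d' : derivation R).

(* (f^-1 D_d')^i for i in Z; (f^-1 D_d')^-1 = D_d'^-1 f. *)
Definition psido_pow (i : int) : psido d' :=
  match i with
  | Posz n => iter n (psido_mul (psido_mono d' f^-1 1)) (psido_one d')
  | Negz n => iter n.+1
      (psido_mul (psido_mul (psido_mono d' 1 (-1)) (psido_mono d' f 0)))
      (psido_one d')
  end.

(* Since (f^-1 D_d')^i has order at most i, only i >= k contributes to the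
   coefficient of D_d'^k. *)
Fact change_der_bounded (a : psido d) :
  exists N : int, forall k, N < k ->
    \sum_(i \in [set i : int | k <= i]) pcoef a i * pcoef (psido_pow i) k = 0.
Proof.
have [N aN] := pcoef_bounded a; exists N => k Nk.
by apply: fsbig1 => i /= ki; rewrite aN ?mul0r// (lt_le_trans Nk).
Qed.

(* The isomorphism i_{d,d'}; meaningful for f a unit and d' = f d. *)
Definition change_der (a : psido d) : psido d' :=
  Psido d' (change_der_bounded a).

End ChangeOfDerivation.

(** * Projective curves *)

(* An integral projective curve in P^n over F, presented by its function field
   and its generic point: the homogeneous ideal of the curve consists of the
   forms vanishing at curve_gen. *)
Record curve (F : fieldType) := Curve {
  curve_field :> fieldType;
  curve_cst : {rmorphism F -> curve_field};
  curve_dim : nat;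
  curve_gen : 'I_curve_dim.+1 -> curve_field;
  curve_gen_neq0 : exists i, curve_gen i != 0;
  curve_generated : forall f : curve_field,
    exists d (p q : {mpoly F[curve_dim.+1]}),
      [/\ p \is d.-homog, q \is d.-homog, mmap curve_cst curve_gen q != 0
        & f = mmap curve_cst curve_gen p / mmap curve_cst curve_gen q];
  (* transcendence degree one over F *)
  curve_transc : exists t, ~ algebraicOver curve_cst t;
  curve_algdep : forall f g : curve_field, exists2 p : {mpoly F[2]},
    p != 0 & mmap curve_cst (fun i => if i == ord0 then f else g) p = 0 }.

(* Closed points; homogeneous coordinates are normalized so that the first
   nonzero one is 1. *)
Record cpoint (F : fieldType) (C : curve F) := CPoint {
  point_coord :> {ffun 'I_(curve_dim C).+1 -> F};
  point_normalized : exists2 i : 'I_(curve_dim C).+1, point_coord i = 1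
    & forall j : 'I_(curve_dim C).+1, (j < i)%N -> point_coord j = 0;
  point_on_curve : forall d (p : {mpoly F[(curve_dim C).+1]}),
    p \is d.-homog -> mmap (curve_cst C) (@curve_gen F C) p = 0 ->
    p.@[point_coord] = 0 }.

Section Curves.
Variables (F : fieldType) (C : curve F).
Implicit Types (P : cpoint C) (f g z : C) (D : cpoint C -> int).

(* f is regular at P and f(P) = c *)
Definition has_value P f (c : F) : Prop :=
  exists d (p q : {mpoly F[(curve_dim C).+1]}),
    [/\ p \is d.-homog, q \is d.-homog, q.@[P] != 0,
        f = mmap (curve_cst C) (@curve_gen F C) p
            / mmap (curve_cst C) (@curve_gen F C) q
      & c = p.@[P] / q.@[P]].

Definition regular_at P f : Prop := exists c, has_value P f c.

(* z generates the maximal ideal of the local ring at P. *)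
Definition local_coordinate P z : Prop :=
  forall f, has_value P f 0 <-> exists2 g, regular_at P g & f = z * g.

(* The local rings, of dimension one, are regular. *)
Definition smooth : Prop := forall P, exists z, local_coordinate P z.

Definition is_divisor D : Prop := finite_set [set P | D P != 0].
Definition effective D : Prop := forall P, 0 <= D P.
Definition zero_div : cpoint C -> int := fun=> 0.

(** ** Vector fields and differentials *)

Record vfield := VField {
  vfield_der :> derivation C;
  vfield_cst : forall c, vfield_der (curve_cst C c) = 0 }.

HB.instance Definition _ := gen_eqMixin vfield.
HB.instance Definition _ := gen_choiceMixin vfield.

Definition zero_vfield : vfield :=
  @VField (zero_der C) (fun=> erefl).

Definition vfield_nonzero (X : vfield) : Prop := exists f, X f != 0.

(* Rational i-differentials are the functions f (dg)^i on vector fields: the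
   space of rational vector fields is a line over the function field, and the
   i-th tensor power of its dual is the space of homogeneous functions of
   degree i on it. *)
Definition differential := vfield -> C.

Definition dpow f g (i : nat) : differential := fun Y => f * Y g ^+ i.

(* H^0(C, K(D)^i), the degree i part of A^(C,D) *)
Definition H0 D (i : nat) : set differential :=
  [set w | forall P z, local_coordinate P z ->
    exists2 h, regular_at P (h * z ^ (i%:Z * D P)) & w = dpow h z i].

(* The genus is the dimension of H^0(C, K). *)
Definition has_genus (g : nat) : Prop :=
  exists2 b : 'I_g -> differential, (forall j, H0 zero_div 1 (b j))
    & forall w, H0 zero_div 1 w -> exists! c : {ffun 'I_g -> F},
        w = fun Y => \sum_j curve_cst C (c j) * b j Y.

(* X^-1, mapping Y to the rational function Y / X *)
Definition inv_vfield (X : vfield) : differential :=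
  fun Y => xget 0 [set f | forall g, Y g = f * X g].

(* The inverse of a nonzero rational 1-differential *)
Definition inv_form (w : differential) : vfield :=
  xget zero_vfield [set X | w X = 1].

(** ** The algebras B *)

(* The Laurent expansion at P is the embedding of the function field in its
   completion F((z)). *)
Definition laurent_expansion P z (e : {rmorphism C -> laurent F}) : Prop :=
  [/\ forall c, e (curve_cst C c) = laurent_mono c 0, e z = laurent_mono 1 1
    & forall f, regular_at P f -> power_series (e f)].

Section Algebras.
Variable X : vfield.

Definition Brat : set (psido X) := order_le X 0.

(* Here X = e (X z) d/dz on Laurent series. *)
Definition expand z (e : {rmorphism C -> laurent F}) (a : psido X) :
    psido (ddz F) :=
  change_der (e (X z))^-1 (ddz F)
    (psido_map e (scale_der (e (X z)) (ddz F)) a).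

(* PsiDO(F[[z]], z)^(delta)_{<= 0} inside PsiDO(F((z)), z) *)
Definition local_psido (delta : int) : set (psido (ddz F)) :=
  [set b | exists c : psido (scale_der (laurent_mono 1 delta) (ddz F)),
    [/\ order_le _ 0 c, forall i, power_series (pcoef c i)
      & b = change_der (laurent_mono 1 (- delta)) (ddz F) c]].

(* B_X^(C,D), for a choice z of a local coordinate at every point *)
Definition Bdiv (z : cpoint C -> C) D : set (psido X) :=
  [set a | Brat a /\ forall P, exists2 e : {rmorphism C -> laurent F},
    laurent_expansion P (z P) e & local_psido (D P) (expand (z P) e a)].

(* The class a_i (X^-1)^i in gr^i of an operator of order at most -i, where a_i
   is the coefficient of D_X^-i *)
Definition symb (i : nat) (a : psido X) : differential :=
  fun Y => pcoef a (- i%:Z) * inv_vfield X Y ^+ i.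

End Algebras.

End Curves.
Arguments zero_div {F} C.
Arguments Brat {F C} X.

(** * Coverings *)

(* A surjective morphism C -> C' (hence finite), given by its action on points
   and on rational functions *)
Record covering (F : fieldType) (C C' : curve F) := Covering {
  cov_pt :> cpoint C -> cpoint C';
  cov_pb : {rmorphism C' -> C};
  cov_cst : forall c, cov_pb (curve_cst C' c) = curve_cst C c;
  cov_value : forall P f c,
    has_value (cov_pt P) f c -> has_value P (cov_pb f) c;
  cov_surj : forall P', exists P, cov_pt P = P' }.

Section Coverings.
Variables (F : fieldType) (C C' : curve F) (phi : covering C C').

(* The valuation at P of the pull-back of a local coordinate at phi P *)
Definition ram_index (P : cpoint C) : nat :=
  xget 0%N [set n | exists z z' u c,
    [/\ local_coordinate P z, local_coordinate (phi P) z',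
        has_value P u c, c != 0 & cov_pb phi z' = u * z ^+ n]].

Definition pullback_div (D' : cpoint C' -> int) (P : cpoint C) : int :=
  D' (phi P) * (ram_index P)%:Z + (1 - (ram_index P)%:Z).

(* phi^*_class in degree i : f (dg)^i |-> phi^*f (d phi^*g)^i *)
Definition pullback (i : nat) (w' : differential C') : differential C :=
  xget (fun=> 0) [set w | exists f g, w' = dpow f g i /\
    w = dpow (cov_pb phi f) (cov_pb phi g) i].

Section Morphisms.
Variables (X' : vfield C') (X : vfield C).

(* h restricts to a unital algebra morphism B' -> B, for the filtrations by the
   order; its values outside B' are irrelevant. Preserving the filtrations, it
   is continuous for the complete topologies that they define. *)
Definition filtered_morphism (B' : set (psido X')) (B : set (psido X))
    (h : psido X' -> psido X) : Prop :=
  [/\ forall a, B' a -> B (h a),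
      h (psido_one X') = psido_one X,
      forall a b, B' a -> B' b -> h (psido_add a b) = psido_add (h a) (h b),
      forall a b, B' a -> B' b -> h (psido_mul a b) = psido_mul (h a) (h b)
    & (forall c a, B' a -> h (psido_scale (curve_cst C' c) a)
         = psido_scale (curve_cst C c) (h a)) /\
      forall (i : nat) a, B' a -> order_le X' (- i%:Z) a ->
        order_le X (- i%:Z) (h a)].

(* The graded map of h : B' -> B is phi^*_class : A^(C',D') -> A^(C,D). *)
Definition quantizes (B' : set (psido X')) (D' : cpoint C' -> int)
    (D : cpoint C -> int) (h : psido X' -> psido X) : Prop :=
  forall i : nat,
    (forall w, H0 D' i w -> H0 D i (pullback i w)) /\
    forall a, B' a -> order_le X' (- i%:Z) a ->
      H0 D' i (symb i a) /\ symb i (h a) = pullback i (symb i a).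

End Morphisms.

End Coverings.

(* Main.v *)
Require Import Defs.
From HB Require Import structures.
From mathcomp Require Import all_boot all_order all_algebra.
From mathcomp Require Import boolp classical_sets functions cardinality fsbigop.
From mathcomp Require Import reals complex mpoly.
From mathcomp Require Import ring zify.
Set Implicit Arguments.
Unset Strict Implicit.
Unset Printing Implicit Defensive.
Import Order.TTheory GRing.Theory Num.Theory.
Local Open Scope classical_set_scope.
Local Open Scope ring_scope.

(** The morphism applies the pull-back pb of functions to the coefficients. The
    vector field X satisfies X (pb f) = pb (X' f), and the product of operators
    is built from the products and the derivation of the coefficients, so it is
    preserved. Such an X exists because the derivations of a function field of
    transcendence degree one form a line (der_along_proportional), and because
    d/dz, in the Laurent series at a point, preserves the function field
    (vfield_coord_ex); that C has a point follows from the finiteness of the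
    genus (genus_point).

    The content is local: the pull-back must respect the integrality conditions
    that define the algebras B. These conditions are stated on Laurent series,
    but the passage from X to the derivation z^delta d/dz takes place over the
    function field, and a function is regular at P exactly when its expansion is
    a power series. So membership in B means that, for every P, the operator has
    regular coefficients once it is written in powers of the symbol of
    z^delta d/dz (BdivP). This uses that the local ring at a smooth point is a
    discrete valuation ring (function_order), which follows from an algebraic
    relation between a function and a local coordinate (function_dvd_poly).

    In order at most 0, passing from a derivation d to f d replaces the inverse
    symbol D_d^-1 by D_(f d)^-1 f, an operation which involves f and its
    derivatives but not f^-1. Its coefficients obey a two-term recursion
    (inv_pow), from which follow naturality, the composition law
    (change_der_comp) and the preservation of a subring that contains f and is
    stable under f d (change_der_closed). Take points P and P' = phi P with
    coordinates z and z', so that pb z' = u z^nu with u(P) nonzero. Then z^delta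
    d/dz is a multiple of the lift of z'^delta' d/dz', and the factor is
    z^(delta - (delta' nu + 1 - nu)) times a regular function
    (ram_factor_regular). It is regular as soon as delta is at least the
    multiplicity delta' nu + 1 - nu of the divisor D, and the coefficients remain
    regular (pullback_Bdiv). For D' = 0 this multiplicity is at most 0, so
    delta = 0 is allowed: both cases of the theorem are instances of one
    statement.

    The leading coefficient is multiplied by a power of the factor
    (change_der_lead), which identifies the symbols of the elements of B with
    global sections; comparing with X shows that their pull-backs are those of
    differentials (pullbackE, symb_H0, pullback_H0). Finally D has finite support
    because zeros, poles and ramification points are finite in number; again an
    algebraic relation bounds the values of the affine coordinates at the zeros
    of a function (finite_zeros). *)

(** * Polynomial relations and derivations *)

Lemma mpoly_ring_ind (n : nat) (A : comNzRingType) (P : {mpoly A[n]} -> Prop) :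
  (forall c, P c%:MP) -> (forall i, P 'X_i) ->
  (forall p q, P p -> P q -> P (p + q)) ->
  (forall p q, P p -> P q -> P (p * q)) -> forall p, P p.
Proof.
move=> PC PX PD PM p; rewrite [p]mpolyE.
apply: (big_ind P) => [||m _]; first by rewrite -mpolyC0.
  by move=> q r; apply: PD.
rewrite -mul_mpolyC; apply: (PM) => //; rewrite mpolyXE_id.
apply: (big_ind P) => [||i _]; first by rewrite -mpolyC1.
  by move=> q r; apply: PM.
elim: (m i) => [|k IH]; first by rewrite expr0 -mpolyC1.
by rewrite exprS; apply: PM.
Qed.

Lemma msize_mderiv_lt (n : nat) (A : nzRingType) (i : 'I_n) (p : {mpoly A[n]}) :
  p^`M(i) != 0 -> (msize p^`M(i) < msize p)%N.
Proof.
move=> dp; rewrite -(mlead_deg dp).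
have := mlead_supp dp; rewrite mcoeff_msupp mcoeff_deriv => ne0.
have : (mlead p^`M(i) + U_(i))%MM \in msupp p.
  by rewrite mcoeff_msupp; apply: contraNN ne0 => /eqP->; rewrite mul0rn.
by move/msize_mdeg_lt; rewrite mdegD mdeg1 addn1.
Qed.

(** Characteristic zero: a coefficient at a nonconstant monomial is seen, up to
    a nonzero integer factor, by one of the partial derivatives. *)
Lemma mderiv_eq0_const (n : nat) (F : fieldType) (p : {mpoly F[n]}) :
  [pchar F] =i pred0 -> (forall i, p^`M(i) = 0) -> p = (p@_0)%:MP.
Proof.
move=> F0 dp0; apply/mpolyP => m; rewrite mcoeffC.
have [<-|m0] := eqVneq 0%MM m; first by rewrite mulr1.
rewrite mulr0; have /existsP[i mi] : [exists i, m i != 0%N].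
  apply: contraNT m0 => /existsPn mE; apply/eqP/mnmP => i; rewrite mnm0E.
  by have := mE i; rewrite negbK => /eqP.
have := congr1 (mcoeff (m - U_(i))) (dp0 i); rewrite mcoeff0 mcoeff_deriv.
rewrite submK; last by rewrite lep1mP.
by move/eqP; rewrite -mulr_natr mulf_eq0 ((pcharf0P F).1 F0) orbF => /eqP.
Qed.

Definition pair_val (T : Type) (f t : T) (i : 'I_2) : T :=
  if i == ord0 then f else t.

Section Derivations.
Variables (F : fieldType) (C : curve F).
Implicit Types f t : C.

(** The values lie in an algebra over the function field, so that vector fields,
    d/dz on Laurent expansions and vector fields on the source of a covering can
    be compared. *)
Definition der_along (L : comNzRingType) (e : {rmorphism C -> L}) (d : C -> L) :=
  [/\ {morph d : x y / x + y}, forall x y, d (x * y) = d x * e y + e x * d y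
    & forall c, d (curve_cst C c) = 0].

Lemma der_along_mmap (L : comNzRingType) (e : {rmorphism C -> L}) d n
    (h : 'I_n -> C) (p : {mpoly F[n]}) : der_along e d ->
  d (mmap (curve_cst C) h p) =
    \sum_i e (mmap (curve_cst C) h p^`M(i)) * d (h i).
Proof.
case=> dD dM dC; elim/mpoly_ring_ind: p => [c|i|p q IHp IHq|p q IHp IHq].
- rewrite mmapC dC big1// => i _.
  by rewrite mderivC !rmorph0 mul0r.
- rewrite mmapX mmap1U (bigD1 i)//= big1 => [|j ji].
    have -> : 'X_i^`M(i) = 1 :> {mpoly F[n]}.
      rewrite mderivX mnm1E eqxx scale1r -mpolyX0; congr mpolyX.
      by apply/mnmP => k; rewrite mnmBE subnn mnm0E.
    by rewrite addr0 !rmorph1 mul1r.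
  by rewrite mderivX mnm1E eq_sym (negPf ji) scale0r !rmorph0 mul0r.
- rewrite rmorphD dD IHp IHq -big_split; apply: eq_bigr => i _.
  by rewrite mderivD !rmorphD mulrDl.
- rewrite rmorphM dM IHp IHq mulr_suml mulr_sumr -big_split.
  apply: eq_bigr => i _ /=; rewrite mderivM !rmorphD !rmorphM/=; ring.
Qed.

(** Take a relation of least degree: its partial derivatives have smaller degree,
    so they vanish at (f, t) only if they are zero, and in characteristic zero
    they are not all zero. *)
Lemma min_relation f t : [pchar F] =i pred0 ->
  exists2 p : {mpoly F[2]}, mmap (curve_cst C) (pair_val f t) p = 0
    & exists i, mmap (curve_cst C) (pair_val f t) p^`M(i) != 0.
Proof.
move=> F0; have [p p0 pE] := curve_algdep f t.
have [n] := ubnP (msize p); elim: n => // n IH in p p0 pE *; rewrite ltnS => pn.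
have [[i di]|nd] := pselect (exists i, mmap (curve_cst C) (pair_val f t) p^`M(i) != 0).
  by exists p => //; exists i.
have dE i : mmap (curve_cst C) (pair_val f t) p^`M(i) = 0.
  by apply/eqP/negPn/negP => di; apply: nd; exists i.
have [dp0|] := pselect (forall i, p^`M(i) = 0).
  move: p0 pE; rewrite (mderiv_eq0_const F0 dp0) mmapC => p0 /eqP.
  by rewrite fmorph_eq0 => /eqP c0; rewrite c0 mpolyC0 eqxx in p0.
move/existsNP => [i /eqP di]; apply: (IH _ di) => //.
exact: leq_trans (msize_mderiv_lt di) pn.
Qed.

Lemma der_along_relation (L : comNzRingType) (e : {rmorphism C -> L}) d f t
    (p : {mpoly F[2]}) : der_along e d ->
  mmap (curve_cst C) (pair_val f t) p = 0 ->
  e (mmap (curve_cst C) (pair_val f t) p^`M(0)) * d f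
  + e (mmap (curve_cst C) (pair_val f t) p^`M(1)) * d t = 0.
Proof.
move=> derd pE; have [dD _ _] := derd.
have d0 : d 0 = 0 by apply: (addrI (d 0)); rewrite -dD !addr0.
have := der_along_mmap (pair_val f t) p derd.
rewrite pE d0 !big_ord_recl big_ord0 addr0 => E; rewrite [RHS]E.
by have -> : lift ord0 ord0 = 1 :> 'I_2 by apply/val_inj.
Qed.

(** The function field has transcendence degree one, so its derivations form a
    line: both vectors (d f, d t) are orthogonal to the gradient of a polynomial
    relation between f and t. *)
Lemma der_along_proportional (L : comUnitRingType) (e : {rmorphism C -> L})
    (d1 d2 : C -> L) f t : [pchar F] =i pred0 ->
  der_along e d1 -> der_along e d2 -> d1 f * d2 t = d1 t * d2 f.
Proof.
move=> F0 der1 der2; have [p pE [i di]] := min_relation f t F0.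
have r1 := der_along_relation der1 pE; have r2 := der_along_relation der2 pE.
have := rmorph_unit e; have {}di : mmap (curve_cst C) (pair_val f t) p^`M(i)
  \is a GRing.unit by rewrite unitfE.
move/(_ _ di); move: r1 r2; case/altP: (i =P 0) => [->|i1].
  set x := e _; set y := e _ => r1 r2 xU; apply: (mulrI xU); apply/eqP.
  rewrite -subr_eq0; apply/eqP.
  transitivity ((x * d1 f + y * d1 t) * d2 t - (x * d2 f + y * d2 t) * d1 t).
    by ring.
  by rewrite r1 r2 !mul0r subr0.
have -> : i = 1 by apply/val_inj; case: i i1 {di} => -[|[]].
set x := e _; set y := e _ => r1 r2 yU; apply: (mulrI yU); apply/eqP.
rewrite -subr_eq0; apply/eqP.
transitivity ((x * d2 f + y * d2 t) * d1 f - (x * d1 f + y * d1 t) * d2 f).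
  by ring.
by rewrite r1 r2 !mul0r subr0.
Qed.

Lemma const_term_split (p : {mpoly F[2]}) :
  exists (p1 : {mpoly F[2]}) (r : {poly F}),
    p = 'X_0 * p1 + (map_poly (@mpolyC 2 F) r).['X_1].
Proof.
elim/mpoly_ring_ind: p => [c|i|p q|p q].
- by exists 0, c%:P; rewrite mulr0 add0r map_polyC hornerC.
- have [->|i1] := eqVneq i 0.
    by exists 1, 0; rewrite mulr1 rmorph0 horner0 addr0.
  have -> : i = 1 by apply/val_inj; case: i i1 => -[|[]].
  by exists 0, 'X; rewrite mulr0 add0r map_polyX hornerX.
- move=> [p1 [r ->]] [q1 [s ->]]; exists (p1 + q1), (r + s).
  by rewrite rmorphD hornerD mulrDr addrACA.
- move=> [p1 [r ->]] [q1 [s ->]].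
  exists (p1 * ('X_0 * q1 + (map_poly (@mpolyC 2 F) s).['X_1])
    + (map_poly (@mpolyC 2 F) r).['X_1] * q1), (r * s).
  by rewrite rmorphM hornerM; ring.
Qed.

(** A nonzero function f divides, in the ring of polynomials in f and t, a
    nonzero polynomial in t alone: the constant term of a relation which f does
    not divide. This bounds the order of vanishing of f when t is a local
    coordinate, and the values of t at the zeros of f. *)
Lemma function_dvd_poly f t : f != 0 ->
  exists (r : {poly F}) (p : {mpoly F[2]}), r != 0 /\
    (map_poly (curve_cst C) r).[t] = f * mmap (curve_cst C) (pair_val f t) p.
Proof.
move=> f0; have [p p0 pE] := curve_algdep f t.
have [n] := ubnP (msize p); elim: n => // n IH in p p0 pE *; rewrite ltnS => pn.
have [p1 [r pr]] := const_term_split p.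
have E : mmap (curve_cst C) (pair_val f t) p
    = f * mmap (curve_cst C) (pair_val f t) p1 + (map_poly (curve_cst C) r).[t].
  rewrite {1}pr rmorphD rmorphM /= mmapX mmap1U; congr (_ + _).
  rewrite -horner_map/= -map_poly_comp mmapX mmap1U; congr _.[_].
  by apply: eq_map_poly => c /=; rewrite mmapC.
have [r0|r0] := eqVneq r 0; last first.
  exists r, (- p1); split=> //; apply/eqP.
  by rewrite -subr_eq0 rmorphN mulrN opprK addrC -E; apply/eqP.
have p10 : p1 != 0.
  by apply: contraNneq p0 => z; rewrite pr z r0 mulr0 rmorph0 horner0 addr0.
apply: (IH p1 p10).
  move/eqP: E; rewrite [mmap _ _ p]pE r0 rmorph0 horner0 addr0 eq_sym mulf_eq0.
  by rewrite (negPf f0) => /eqP.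
apply: leq_trans pn; rewrite pr r0 rmorph0 horner0 addr0.
have X0 : 'X_0 != 0 :> {mpoly F[2]} by rewrite -msize_poly_eq0 msizeX.
by rewrite (msizeM X0 p10) msizeX mdeg1.
Qed.

End Derivations.

(** * Local rings *)

Section LocalRing.
Variables (F : fieldType) (C : curve F) (P : cpoint C).
Implicit Types (f g z : C) (c : F).

Local Notation ev := (mmap (curve_cst C) (@curve_gen F C)).

Lemma ev_homog_neq0 d (q : {mpoly F[(curve_dim C).+1]}) :
  q \is d.-homog -> q.@[P] != 0 -> ev q != 0.
Proof. by move=> qd; apply: contra_neq => /(point_on_curve P qd). Qed.

(** Two presentations of f as a fraction give a form p q' - p' q that vanishes at
    the generic point, hence at P. *)
Lemma has_value_uniq f c c' : has_value P f c -> has_value P f c' -> c = c'.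
Proof.
move=> [d [p [q [pd qd qP fE ->]]]] [d' [p' [q' [pd' qd' qP' fE' ->]]]].
have q0 := ev_homog_neq0 qd qP; have q0' := ev_homog_neq0 qd' qP'.
have : (p * q' - p' * q).@[P] = 0.
  apply: (@point_on_curve _ _ P (d + d')%N).
    by apply: rpredB; [|rewrite addnC]; apply: dhomogM.
  rewrite rmorphB !rmorphM; apply/eqP.
  by rewrite subr_eq0 -eqr_div// -fE fE'.
by rewrite rmorphB !rmorphM => /eqP; rewrite subr_eq0 -eqr_div// => /eqP.
Qed.

Lemma has_value_cst c : has_value P (curve_cst C c) c.
Proof.
exists 0%N, c%:MP, 1; split; rewrite ?dhomog1//.
- by rewrite -[c%:MP]mulr1 mul_mpolyC; apply/dhomogZ/dhomog1.
- by rewrite rmorph1 oner_neq0.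
- by rewrite mmapC rmorph1 divr1.
- by rewrite mevalC rmorph1 divr1.
Qed.

Lemma has_value0 : has_value P 0 0.
Proof. by have := has_value_cst 0; rewrite rmorph0. Qed.

Lemma has_value1 : has_value P 1 1.
Proof. by have := has_value_cst 1; rewrite rmorph1. Qed.

Lemma has_valueD f g c c' :
  has_value P f c -> has_value P g c' -> has_value P (f + g) (c + c').
Proof.
move=> [d [p [q [pd qd qP -> ->]]]] [d' [p' [q' [pd' qd' qP' -> ->]]]].
have q0 := ev_homog_neq0 qd qP; have q0' := ev_homog_neq0 qd' qP'.
exists (d + d')%N, (p * q' + p' * q), (q * q'); split.
- by apply: rpredD; [|rewrite addnC]; apply: dhomogM.
- by rewrite dhomogM.
- by rewrite rmorphM mulf_neq0.
- by rewrite addf_div// rmorphD !rmorphM.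
- by rewrite addf_div// rmorphD !rmorphM.
Qed.

Lemma has_valueM f g c c' :
  has_value P f c -> has_value P g c' -> has_value P (f * g) (c * c').
Proof.
move=> [d [p [q [pd qd qP -> ->]]]] [d' [p' [q' [pd' qd' qP' -> ->]]]].
exists (d + d')%N, (p * p'), (q * q'); split; rewrite ?dhomogM//.
- by rewrite rmorphM mulf_neq0.
- by rewrite mulf_div !rmorphM.
- by rewrite mulf_div !rmorphM.
Qed.

Lemma has_valueN f c : has_value P f c -> has_value P (- f) (- c).
Proof.
move=> h; have := has_valueM (has_value_cst (-1)) h.
by rewrite rmorphN1 !mulN1r.
Qed.

Lemma has_valueB f g c c' :
  has_value P f c -> has_value P g c' -> has_value P (f - g) (c - c').
Proof. by move=> fc /has_valueN; apply: has_valueD. Qed.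

Lemma has_valueX f c n : has_value P f c -> has_value P (f ^+ n) (c ^+ n).
Proof.
move=> h; elim: n => [|n IH]; first exact: has_value1.
by rewrite !exprS; apply: has_valueM.
Qed.

Lemma has_valueV f c : c != 0 -> has_value P f c -> has_value P f^-1 c^-1.
Proof.
move=> c0 [d [p [q [pd qd qP fE cE]]]]; exists d, q, p; split=> //.
- by apply: contra_neq c0; rewrite cE => ->; rewrite mul0r.
- by rewrite fE invf_div.
- by rewrite cE invf_div.
Qed.

Lemma has_value_neq0 f c : c != 0 -> has_value P f c -> f != 0.
Proof.
by move=> c0 fc; apply: contra_neq c0 => f0; rewrite f0 in fc;
  apply: has_value_uniq fc has_value0.
Qed.

Lemma has_value_mmap n (h : 'I_n -> C) (v : 'I_n -> F) (p : {mpoly F[n]}) :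
  (forall i, has_value P (h i) (v i)) ->
  has_value P (mmap (curve_cst C) h p) p.@[v].
Proof.
move=> hv; elim/mpoly_ring_ind: p => [c|i|p q IHp IHq|p q IHp IHq].
- by rewrite mmapC mevalC; apply: has_value_cst.
- by rewrite mmapX mmap1U mevalXU.
- by rewrite !rmorphD; apply: has_valueD.
- by rewrite !rmorphM; apply: has_valueM.
Qed.

Lemma has_value_horner (r : {poly F}) f c :
  has_value P f c -> has_value P (map_poly (curve_cst C) r).[f] r.[c].
Proof.
move=> fc; elim/poly_ind: r => [|r a IH].
  by rewrite rmorph0 !horner0; apply: has_value0.
rewrite rmorphD rmorphM /= map_polyX map_polyC !hornerMXaddC.
by apply: has_valueD; [apply: has_valueM|apply: has_value_cst].
Qed.

Lemma regular_value f c : has_value P f c -> regular_at P f.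
Proof. by exists c. Qed.

Lemma regular0 : regular_at P 0. Proof. by exists 0; apply: has_value0. Qed.
Lemma regular1 : regular_at P 1. Proof. by exists 1; apply: has_value1. Qed.
Lemma regular_cst c : regular_at P (curve_cst C c).
Proof. by exists c; apply: has_value_cst. Qed.
Lemma regularD f g : regular_at P f -> regular_at P g -> regular_at P (f + g).
Proof. by move=> [a fa] [b gb]; exists (a + b); apply: has_valueD. Qed.
Lemma regularN f : regular_at P f -> regular_at P (- f).
Proof. by move=> [a fa]; exists (- a); apply: has_valueN. Qed.
Lemma regularB f g : regular_at P f -> regular_at P g -> regular_at P (f - g).
Proof. by move=> rf rg; apply: regularD => //; apply: regularN. Qed.
Lemma regularM f g : regular_at P f -> regular_at P g -> regular_at P (f * g).
Proof. by move=> [a fa] [b gb]; exists (a * b); apply: has_valueM. Qed.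
Lemma regularX f n : regular_at P f -> regular_at P (f ^+ n).
Proof. by move=> [a fa]; exists (a ^+ n); apply: has_valueX. Qed.
Lemma regular_nat n : regular_at P n%:R.
Proof. by rewrite -(rmorph_nat (curve_cst C)); apply: regular_cst. Qed.

(** Dividing by a power of a coordinate not vanishing at P makes the numerator
    and the denominator of a homogeneous fraction regular. *)
Lemma fraction_regular f :
  exists f1 f2, [/\ regular_at P f1, regular_at P f2, f2 != 0 & f = f1 / f2].
Proof.
have [d [p [q [pd qd q0 ->]]]] := curve_generated f.
have [i Pi _] := point_normalized P.
pose l : {mpoly F[(curve_dim C).+1]} := 'X_i ^+ d.
have ld : l \is d.-homog.
  by rewrite /l -[d in d.-homog]mul1n; apply: dhomogMn; rewrite dhomogX; apply/eqP/mdeg1.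
have lP : l.@[P] != 0 by rewrite rmorphXn /= mevalXU Pi expr1n oner_neq0.
have l0 := ev_homog_neq0 ld lP.
exists (ev p / ev l), (ev q / ev l); split.
- by eexists; exists d, p, l; split.
- by eexists; exists d, q, l; split.
- by rewrite mulf_neq0 ?invr_neq0.
- by field; rewrite l0 q0.
Qed.

Section Coordinate.
Variable z : C.
Hypothesis zP : local_coordinate P z.

Lemma coord_value0 : has_value P z 0.
Proof. by apply/zP; exists 1; rewrite ?mulr1//; apply: regular1. Qed.

Lemma coord_regular : regular_at P z.
Proof. by exists 0; apply: coord_value0. Qed.

Lemma value0_dvd f : has_value P f 0 -> exists2 g, regular_at P g & f = z * g.
Proof. by move/zP. Qed.

Lemma coord_neq0 : z != 0.
Proof.
apply/eqP => z0.
have const f : regular_at P f -> exists c, f = curve_cst C c.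
  move=> [c fc]; exists c; apply/eqP; rewrite -subr_eq0.
  have : has_value P (f - curve_cst C c) 0.
    by rewrite -(subrr c); apply: has_valueB => //; apply: has_value_cst.
  by move=> /value0_dvd[g _ ->]; rewrite z0 mul0r.
have [t] := curve_transc C; apply.
have [f1 [f2 [/const[a ->] /const[b ->] _ ->]]] := fraction_regular t.
exists ('X - (a / b)%:P); first by rewrite polyXsubC_eq0.
rewrite rmorphB /= map_polyX map_polyC root_XsubC. by rewrite -fmorph_div.
Qed.

(** A nonzero regular function has finite order of vanishing: it divides some
    nonzero polynomial r in z, and the order of r at 0 bounds its own. *)
Lemma regular_order f : regular_at P f -> f != 0 ->
  exists (n : nat) u c, [/\ has_value P u c, c != 0 & f = u * z ^+ n].
Proof.
move=> rf f0.
have [r [p [r0 rE]]] := function_dvd_poly z f0.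
have [k [r1 r1P rk]] := multiplicity_XsubC r 0.
rewrite r0 /= in r1P; rewrite subr0 in rk.
have {}r1P : r1.[0] != 0 by rewrite -rootE.
pose s := mmap (curve_cst C) (pair_val f z) p; rewrite -/s in rE.
have rs : regular_at P s.
  have [a fa] := rf; exists (p.@[pair_val a 0]); apply: has_value_mmap => i.
  by rewrite /pair_val; case: ifP => // _; apply: coord_value0.
have bound n g : regular_at P g -> f = g * z ^+ n -> (n <= k)%N.
  move=> rg fE; rewrite leqNgt; apply/negP => kn.
  have := rE; rewrite rk rmorphM rmorphXn /= map_polyX hornerM hornerXn fE.
  rewrite -(subnK kn) addnS exprS exprD => E.
  have {E} E : (map_poly (curve_cst C) r1).[z] = z * (g * z ^+ (n - k.+1) * s).
    by apply: (mulIf (expf_neq0 k coord_neq0)); rewrite E; ring.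
  have : has_value P (map_poly (curve_cst C) r1).[z] 0.
    apply/zP; exists (g * z ^+ (n - k.+1) * s) => //.
    by do !apply: regularM => //; apply/regularX/coord_regular.
  move=> /(has_value_uniq (has_value_horner r1 coord_value0)) /eqP.
  by rewrite (negPf r1P).
pose dvd n := `[< exists2 g, regular_at P g & f = g * z ^+ n >].
have dvd0 : exists n, dvd n.
  by exists 0%N; apply/asboolP; exists f => //; rewrite expr0 mulr1.
have dvd_le n : dvd n -> (n <= k)%N by move=> /asboolP[g]; apply: bound.
case: (ex_maxnP dvd0 dvd_le) => n /asboolP[u ru fE] nmax; have [c uc] := ru.
exists n, u, c; split=> //; apply/eqP => c0; rewrite c0 in uc.
have [g rg ug] := value0_dvd uc.
suff /nmax : dvd n.+1 by rewrite ltnn.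
by apply/asboolP; exists g => //; rewrite fE ug exprS; ring.
Qed.

Lemma function_order f : f != 0 ->
  exists (n : int) u c, [/\ has_value P u c, c != 0 & f = u * z ^ n].
Proof.
have [f1 [f2 [r1 r2 f20 ->]]] := fraction_regular f.
rewrite mulf_eq0 invr_eq0 (negPf f20) orbF => f10.
have [n [u [c [uc c0 ->]]]] := regular_order r1 f10.
have [m [v [b [vb b0 ->]]]] := regular_order r2 f20.
exists (n%:Z - m%:Z), (u / v), (c / b); split.
- by apply: has_valueM => //; apply: has_valueV.
- by rewrite mulf_neq0// invr_neq0.
- by rewrite expfzDr ?coord_neq0// -invr_expz -!exprnP invfM mulrACA.
Qed.

End Coordinate.

Lemma coord_quotient z1 z2 : local_coordinate P z1 -> local_coordinate P z2 ->
  exists u c, [/\ has_value P u c, c != 0 & z1 = u * z2].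
Proof.
move=> z1P z2P.
have [g [a ga] E1] := value0_dvd z2P (coord_value0 z1P).
have [h [b hb] E2] := value0_dvd z1P (coord_value0 z2P).
exists g, a; split; rewrite // 1?mulrC//.
have gh : g * h = 1.
  apply: (mulfI (coord_neq0 z2P)); rewrite mulrA -E1 -E2 mulr1 //.
have := has_valueM ga hb; rewrite gh => /(has_value_uniq has_value1) /esym ab.
by apply/eqP => a0; move: ab; rewrite a0 mul0r => /eqP; rewrite eq_sym oner_eq0.
Qed.

End LocalRing.

(** * Laurent expansions *)

Section LaurentMonomials.
Variable F : fieldType.
Implicit Types f : laurent F.

Lemma laurent_addE f g k : (f + g) k = f k + g k.
Proof. by []. Qed.

Lemma laurent_monoM (c : F) (n : int) f k : (laurent_mono c n * f) k = c * f (k - n).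
Proof.
rewrite -[LHS]/(laurent_conv (laurent_mono c n) f k) /laurent_conv.
rewrite (fsbigE [:: n]) //; last first.
  by move=> i _ /=; rewrite inE; case: eqP => // _; rewrite mul0r.
by rewrite big_cons big_nil in_setT /= eqxx addr0.
Qed.

Lemma laurent_mono_mul (c d : F) (m n : int) :
  laurent_mono c m * laurent_mono d n = laurent_mono (c * d) (m + n).
Proof.
apply: laurentP => k; rewrite laurent_monoM /= subr_eq addrC.
by rewrite (addrC m); case: ifP; rewrite ?mulr0.
Qed.

Lemma laurent_mono1 : laurent_mono 1 0 = 1 :> laurent F.
Proof. by []. Qed.

Lemma laurent_mono_unit (n : int) : laurent_mono (1 : F) n \is a GRing.unit.
Proof.
apply/unitrP; exists (laurent_mono 1 (- n)).
by rewrite !laurent_mono_mul mulr1 addrC subrr.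
Qed.

Lemma laurent_monoV (n : int) :
  (laurent_mono (1 : F) n)^-1 = laurent_mono 1 (- n).
Proof.
apply: (mulrI (laurent_mono_unit n)); rewrite divrr ?laurent_mono_unit//.
by rewrite laurent_mono_mul mulr1 subrr.
Qed.

Lemma laurent_monoX (n : int) : laurent_mono (1 : F) 1 ^ n = laurent_mono 1 n.
Proof.
have pos (m : nat) : laurent_mono (1 : F) 1 ^+ m = laurent_mono 1 m.
  elim: m => [|m IH]; first by rewrite expr0.
  by rewrite exprS IH laurent_mono_mul mulr1.
case: n => n; first exact: pos.
by rewrite NegzE -invr_expz -exprnP pos laurent_monoV.
Qed.

End LaurentMonomials.

Section Expansion.
Variables (F : fieldType) (C : curve F) (P : cpoint C) (z : C).
Hypothesis zP : local_coordinate P z.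
Implicit Types (f g : C) (c : F).

Definition value f : F := xget 0 [set c | has_value P f c].
Definition tail f : C := (f - curve_cst C (value f)) / z.
(** Since f = f(P) + z * tail f, each application of tail shifts the coefficients
    of the expansion of f by one. *)
Definition taylor (n : nat) f : F := value (iter n tail f).

Lemma valueE f c : has_value P f c -> value f = c.
Proof.
move=> fc; apply: (@has_value_uniq _ _ P f) => //.
exact: (@xgetPex _ 0 [set c | has_value P f c] (ex_intro _ c fc)).
Qed.

Lemma tailE f : f = curve_cst C (value f) + z * tail f.
Proof. by rewrite mulrC divfK ?(coord_neq0 zP)// addrC subrK. Qed.

Lemma tail_unique f g c :
  regular_at P g -> f = curve_cst C c + z * g -> value f = c /\ tail f = g.
Proof.
move=> [b gb] fE; have fc : value f = c.
  apply: valueE; rewrite fE -[c in has_value _ _ c]addr0 -(mul0r b).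
  apply: has_valueD; first exact: has_value_cst.
  by apply: has_valueM => //; apply: coord_value0.
by split=> //; rewrite /tail fc fE [_ + z * g]addrC addrK mulrC mulKf ?(coord_neq0 zP).
Qed.

Lemma tail_regular f : regular_at P f -> regular_at P (tail f).
Proof.
move=> [c fc]; have : has_value P (f - curve_cst C (value f)) 0.
  by rewrite (valueE fc) -(subrr c); apply: has_valueB => //; apply: has_value_cst.
case/(value0_dvd zP) => g rg gE.
by rewrite /tail gE mulrC mulKf ?(coord_neq0 zP).
Qed.

Lemma taylorS n f : taylor n.+1 f = taylor n (tail f).
Proof. by rewrite /taylor iterSr. Qed.

Lemma taylorD n f g : regular_at P f -> regular_at P g ->
  taylor n (f + g) = taylor n f + taylor n g.
Proof.
elim: n f g => [|n IH] f g rf rg; have rtf := tail_regular rf;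
  have rtg := tail_regular rg; have [v t] : value (f + g) = value f + value g
    /\ tail (f + g) = tail f + tail g.
- apply: tail_unique; first exact: regularD.
  by rewrite {1}[f]tailE {1}[g]tailE rmorphD; ring.
- exact: v.
- apply: tail_unique; first exact: regularD.
  by rewrite {1}[f]tailE {1}[g]tailE rmorphD; ring.
- by rewrite !taylorS t IH.
Qed.

Lemma taylor_scale n f c : regular_at P f ->
  taylor n (curve_cst C c * f) = c * taylor n f.
Proof.
elim: n f => [|n IH] f rf; have rtf := tail_regular rf;
  have [v t] : value (curve_cst C c * f) = c * value f
    /\ tail (curve_cst C c * f) = curve_cst C c * tail f.
- apply: tail_unique; first by apply: regularM => //; apply: regular_cst.
  by rewrite {1}[f]tailE rmorphM; ring.
- exact: v.
- apply: tail_unique; first by apply: regularM => //; apply: regular_cst.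
  by rewrite {1}[f]tailE rmorphM; ring.
- by rewrite !taylorS t IH.
Qed.

Lemma taylorM n f g : regular_at P f -> regular_at P g ->
  taylor n (f * g) = \sum_(i < n.+1) taylor i f * taylor (n - i) g.
Proof.
move=> rf rg; elim: n f rf => [|n IH] f rf; have rtf := tail_regular rf;
  have rtg := tail_regular rg; have [v t] : value (f * g) = value f * value g
    /\ tail (f * g) = tail f * g + curve_cst C (value f) * tail g.
- apply: tail_unique.
    by apply: regularD; apply: regularM => //; apply: regular_cst.
  by rewrite {1}[f]tailE mulrDl {1}[g]tailE rmorphM; ring.
- by rewrite big_ord1.
- apply: tail_unique.
    by apply: regularD; apply: regularM => //; apply: regular_cst.
  by rewrite {1}[f]tailE mulrDl {1}[g]tailE rmorphM; ring.
- rewrite taylorS t taylorD; last 2 first.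
  + exact: regularM.
  + by apply: regularM => //; apply: regular_cst.
  rewrite IH// taylor_scale// [RHS]big_ord_recl [RHS]addrC subn0 -taylorS; congr (_ + _).
  by apply: eq_bigr => i _; rewrite taylorS.
Qed.

Lemma taylor_coordM n f : regular_at P f ->
  taylor 0 (z * f) = 0 /\ taylor n.+1 (z * f) = taylor n f.
Proof.
move=> rf; rewrite taylorS.
have [v t] : value (z * f) = 0 /\ tail (z * f) = f.
  by apply: tail_unique; rewrite // rmorph0 add0r.
by rewrite t.
Qed.

(** The coefficients of a function with a pole of order at most n at P are the
    Taylor coefficients of its product with z^n; n does not matter. *)
Definition taylorz (k : int) f : F := if k is Posz n then taylor n f else 0.

Lemma taylorz_coordX (n : nat) k f : regular_at P f ->
  taylorz (k + n%:Z) (f * z ^+ n) = taylorz k f.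
Proof.
move=> rf; elim: n => [|n IH]; first by rewrite addr0 expr0 mulr1.
rewrite -{}IH; have : regular_at P (f * z ^+ n).
  by apply: regularM => //; apply/regularX/coord_regular.
rewrite exprS mulrCA -addn1 PoszD addrA.
move: (k + n%:Z) (f * z ^+ n) => [m|[|m]] h rh.
- by rewrite -PoszD addn1 /= (taylor_coordM m rh).2.
- by rewrite NegzE addrC subrr /= (taylor_coordM 0 rh).1.
- by rewrite NegzE -addn1 PoszD opprD subrK.
Qed.

Lemma pole_ex f : exists n : nat, regular_at P (f * z ^+ n).
Proof.
have [->|f0] := eqVneq f 0; first by exists 0%N; rewrite mul0r; apply: regular0.
have [[n|n] [u [c [uc c0 ->]]]] := function_order zP f0.
  exists 0%N; rewrite expr0 mulr1; apply: regularM; first by exists c.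
  exact/regularX/(coord_regular zP).
exists n.+1; rewrite NegzE -invr_expz -exprnP mulfVK ?expf_neq0 ?(coord_neq0 zP)//.
by exists c.
Qed.

Definition pole f : nat := xget 0%N [set n | regular_at P (f * z ^+ n)].

Lemma poleP f : regular_at P (f * z ^+ pole f).
Proof. exact: (@xgetPex _ 0%N [set n | regular_at P (f * z ^+ n)] (pole_ex f)). Qed.

Definition laurent_fun f (k : int) : F := taylorz (k + (pole f)%:Z) (f * z ^+ pole f).

Lemma laurent_funE (n : nat) f k : regular_at P (f * z ^+ n) ->
  laurent_fun f k = taylorz (k + n%:Z) (f * z ^+ n).
Proof.
move=> rn; have rp := poleP f; rewrite /laurent_fun.
rewrite -(taylorz_coordX n _ rp) -(taylorz_coordX (pole f) _ rn).
by rewrite addrAC mulrAC.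
Qed.

Lemma laurent_fun_low (n : nat) f k : regular_at P (f * z ^+ n) ->
  k < - n%:Z -> laurent_fun f k = 0.
Proof.
move=> rn kn; rewrite (laurent_funE _ rn).
have : k + n%:Z < 0 by rewrite -ltrBrDr sub0r.
by case: (k + n%:Z).
Qed.

Lemma laurent_fun_high (n : nat) f (m : nat) : regular_at P (f * z ^+ n) ->
  laurent_fun f (- n%:Z + m%:Z) = taylor m (f * z ^+ n).
Proof. by move=> rn; rewrite (laurent_funE _ rn) addrAC addNr add0r. Qed.

Fact laurent_fun_bounded f : exists m : int, forall k, k < m -> laurent_fun f k = 0.
Proof. by exists (- (pole f)%:Z) => k; apply/laurent_fun_low/poleP. Qed.

Definition laurent_of f : laurent F := Laurent (laurent_fun_bounded f).

Lemma laurent_ofD f g : laurent_of (f + g) = laurent_of f + laurent_of g.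
Proof.
pose n := (pole f + pole g)%N.
have rf : regular_at P (f * z ^+ n).
  rewrite exprD mulrA; apply: regularM; first exact: poleP.
  exact/regularX/(coord_regular zP).
have rg : regular_at P (g * z ^+ n).
  rewrite /n addnC exprD mulrA; apply: regularM; first exact: poleP.
  exact/regularX/(coord_regular zP).
apply: laurentP => k; rewrite laurent_addE /=.
rewrite !(@laurent_funE n)//; last by rewrite mulrDl; apply: regularD.
rewrite mulrDl; case: (k + n%:Z) => [m|m] /=; last by rewrite addr0.
exact: taylorD.
Qed.

Lemma laurent_ofM f g : laurent_of (f * g) = laurent_of f * laurent_of g.
Proof.
have rf := poleP f; have rg := poleP g; set a := pole f in rf; set b := pole g in rg.
have rfg : regular_at P (f * g * z ^+ (a + b)).
  by rewrite exprD mulrACA; apply: regularM.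
have lf k : k < - a%:Z -> laurent_of f k = 0 by apply: laurent_fun_low.
have lg k : k < - b%:Z -> laurent_of g k = 0 by apply: laurent_fun_low.
have ab : - (a + b)%N%:Z = - a%:Z + - b%:Z by rewrite PoszD opprD.
apply: (@laurent_ind_coef _ _ _ (- a%:Z + - b%:Z)) => k.
- by rewrite -ab; apply: laurent_fun_low.
- exact: laurent_conv0.
rewrite [in RHS]laurent_mulE// -ab [LHS]laurent_fun_high// exprD mulrACA taylorM//.
by apply: eq_bigr => i _; rewrite ![laurent_of _ _]laurent_fun_high.
Qed.

Lemma laurent_of_cst c : laurent_of (curve_cst C c) = laurent_mono c 0.
Proof.
apply: laurentP => k; rewrite /= (@laurent_funE 0); last first.
  by rewrite expr0 mulr1; apply: regular_cst.
rewrite expr0 mulr1 addr0.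
have [v t] : value (curve_cst C c) = c /\ tail (curve_cst C c) = 0.
  by apply: tail_unique; [apply: regular0|rewrite mulr0 addr0].
have t0 n : taylor n 0 = 0.
  have := @taylor_scale n 0 0 (regular0 P); by rewrite mulr0 mul0r.
by case: k => [[|n]|n] //=; rewrite taylorS t t0.
Qed.

Lemma laurent_of_coord : laurent_of z = laurent_mono 1 1.
Proof.
have E k : laurent_of z k = laurent_of 1 (k - 1).
  rewrite /= (@laurent_funE 0); last first.
    by rewrite expr0 mulr1; apply: (coord_regular zP).
  rewrite (@laurent_funE 0); last by rewrite expr0 mulr1; apply: regular1.
  rewrite !expr0 !mulr1 !addr0 -(taylorz_coordX 1 (k - 1) (regular1 P)).
  by rewrite mul1r expr1 subrK.
have E1 : laurent_of 1 = laurent_mono 1 0 by rewrite -laurent_of_cst rmorph1.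
by apply: laurentP => k; rewrite E E1 /= subr_eq0.
Qed.

(** Taylor coefficients are additive, and multiply by the Cauchy product; a power
    of z clears the poles. *)
Lemma laurent_expansion_ex :
  exists e : {rmorphism C -> laurent F}, laurent_expansion P z e.
Proof.
have addM : zmod_morphism laurent_of.
  move=> f g; apply: (addIr (laurent_of g)).
  by rewrite -laurent_ofD !subrK.
have mulM : monoid_morphism laurent_of.
  split; last exact: laurent_ofM.
  by rewrite -laurent_mono1 -laurent_of_cst rmorph1.
pose e : {rmorphism C -> laurent F} := HB.pack laurent_of
  (GRing.isZmodMorphism.Build _ _ laurent_of addM)
  (GRing.isMonoidMorphism.Build _ _ laurent_of mulM).
exists e; split; [exact: laurent_of_cst|exact: laurent_of_coord|].
move=> f rf k k0; apply: (@laurent_fun_low 0); last by rewrite oppr0.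
by rewrite expr0 mulr1.
Qed.

End Expansion.

Section ExpansionTheory.
Variables (F : fieldType) (C : curve F) (P : cpoint C) (z : C).
Variable e : {rmorphism C -> laurent F}.
Hypotheses (F0 : [pchar F] =i pred0) (zP : local_coordinate P z).
Hypothesis eP : laurent_expansion P z e.
Implicit Types (f g : C) (c : F) (X : vfield C).

Lemma expansion_unit f : f != 0 -> e f \is a GRing.unit.
Proof. by move=> f0; apply: rmorph_unit; rewrite unitfE. Qed.

Lemma expansion_inj : injective e.
Proof.
move=> f g fg; apply/eqP; rewrite -subr_eq0; apply: contraT => /expansion_unit.
by rewrite rmorphB fg subrr unitr0.
Qed.

Lemma expansion_coordX (n : int) : e (z ^ n) = laurent_mono 1 n.
Proof.
have [_ ez _] := eP.
by rewrite rmorphXz ?unitfE ?(coord_neq0 zP)// ez laurent_monoX.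
Qed.

Lemma expansion_value f c : has_value P f c -> e f 0 = c.
Proof.
move=> fc; have [ec ez epow] := eP.
have : has_value P (f - curve_cst C c) 0.
  by rewrite -(subrr c); apply: has_valueB => //; apply: has_value_cst.
case/(value0_dvd zP) => g rg gE.
have -> : f = curve_cst C c + z * g by rewrite -gE addrC subrK.
rewrite rmorphD rmorphM ec ez laurent_addE laurent_monoM /=.
by rewrite (epow g rg) // mulr0 addr0.
Qed.

(** The expansion of u z^n with u(P) nonzero starts in degree n, for any
    embedding e in the Laurent series that respects the local ring. *)
Lemma expansion_regular f : power_series (e f) <-> regular_at P f.
Proof.
split=> [pf|]; last by have [_ _ epow] := eP; apply: epow.
have [->|f0] := eqVneq f 0; first exact: regular0.
have [[n|n] [u [c [uc c0 fE]]]] := function_order zP f0.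
  rewrite fE; apply: regularM; first by exists c.
  exact/regularX/(coord_regular zP).
have /eqP := pf (Negz n) isT.
rewrite fE rmorphM expansion_coordX mulrC laurent_monoM subrr mul1r.
by rewrite (expansion_value uc) (negPf c0).
Qed.

Lemma der_along_vfield X : der_along e (e \o X).
Proof.
split=> [x y|x y|c] /=; first by rewrite derD rmorphD.
  by rewrite derM rmorphD !rmorphM.
by rewrite vfield_cst rmorph0.
Qed.

Lemma der_along_ddz : der_along e (ddz F \o e).
Proof.
split=> [x y|x y|c]; rewrite /comp; first by rewrite rmorphD (derD (ddz F)).
  by rewrite rmorphM (derM (ddz F)).
have [-> _ _] := eP; apply: laurentP => k /=.
by case: eqP => [->|_]; rewrite ?mulr0z ?mul0rz if_same.
Qed.

Lemma ddz_coord : ddz F (e z) = 1.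
Proof.
have [_ -> _] := eP; apply: laurentP => k /=.
by rewrite -[X in _ == X]add0r (inj_eq (addIr 1)); case: eqP => [->|_]; rewrite ?mul0rz.
Qed.

(** X and d/dz are proportional as derivations with values in the Laurent series,
    and the factor is seen at z, where d/dz takes the value 1. *)
Lemma expansion_der X f : e (X f) = e (X z) * ddz F (e f).
Proof.
have := der_along_proportional f z F0 (der_along_vfield X) der_along_ddz.
by rewrite /comp ddz_coord mulr1.
Qed.

Lemma expansion_vfield_neq0 X : vfield_nonzero X -> X z != 0.
Proof.
move=> [f]; apply: contra_neq => Xz; apply: expansion_inj.
by rewrite expansion_der Xz !rmorph0 mul0r.
Qed.

Lemma expansion_der_coord X f : vfield_nonzero X ->
  e (X f / X z) = ddz F (e f).
Proof.
move=> /expansion_vfield_neq0 Xz; rewrite mulrC rmorphM.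
rewrite expansion_der mulrA -rmorphM mulVf//.
by rewrite rmorph1 mul1r.
Qed.

Lemma power_series_ddz (s : laurent F) : power_series s -> power_series (ddz F s).
Proof.
move=> ps k k0 /=; case: (ltP (k + 1) 0) => [/ps->|]; first by rewrite mul0rz.
case: k k0 => [|[|k]]// _ _.
Qed.

(** The derivation d/dz of the Laurent series preserves the function field: its
    values on functions are given by the gradients of polynomial relations. *)
Lemma vfield_coord_ex : exists X : vfield C, X z = 1.
Proof.
have ddz_fun f : exists g, ddz F (e f) = e g.
  have [p pE [i di]] := min_relation f z F0.
  have := der_along_relation der_along_ddz pE; rewrite /comp ddz_coord mulr1.
  set x := mmap _ _ p^`M(0); set y := mmap _ _ p^`M(1) => E.
  have x0 : x != 0.
    apply/eqP => x0; have y0 : y = 0.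
      by apply: expansion_inj; rewrite rmorph0 -E x0 rmorph0 mul0r add0r.
    have [i0|i1] := eqVneq i 0; first by move: di; rewrite i0 -/x x0 eqxx.
    have i_1 : i = 1 by apply/val_inj; case: i i1 {di} => -[|[]].
    by move: di; rewrite i_1 -/y y0 eqxx.
  exists (- (y / x)); apply: (mulrI (expansion_unit x0)).
  rewrite -rmorphM mulrN mulrCA divff// mulr1 rmorphN; apply/eqP.
  by rewrite -addr_eq0 E.
pose X0 f := xget 0 [set g | ddz F (e f) = e g].
have X0E f : e (X0 f) = ddz F (e f).
  exact/esym/(@xgetPex _ 0 [set g | ddz F (e f) = e g] (ddz_fun f)).
have X0D : {morph X0 : x y / x + y}.
  by move=> x y; apply: expansion_inj; rewrite rmorphD !X0E rmorphD (derD (ddz F)).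
have X0M x y : X0 (x * y) = X0 x * y + x * X0 y.
  by apply: expansion_inj; rewrite rmorphD !rmorphM !X0E rmorphM (derM (ddz F)).
have X0C c : Derivation X0D X0M (curve_cst C c) = 0.
  apply: expansion_inj; rewrite X0E rmorph0.
  by have [_ _] := der_along_ddz; apply.
exists (VField X0C); apply: expansion_inj.
by rewrite rmorph1 -ddz_coord -X0E.
Qed.

End ExpansionTheory.

Lemma vfield_coord_neq0 (F : fieldType) (C : curve F) (P : cpoint C) z
    (X : vfield C) : [pchar F] =i pred0 -> local_coordinate P z ->
  vfield_nonzero X -> X z != 0.
Proof.
by move=> F0 /laurent_expansion_ex[e eP]; apply: (expansion_vfield_neq0 F0 eP).
Qed.

(** The derivation d/dz preserves the local ring at P, as it preserves the power
    series. *)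
Lemma der_coord_regular (F : fieldType) (C : curve F) (P : cpoint C) z
    (X : vfield C) f : [pchar F] =i pred0 -> local_coordinate P z ->
  vfield_nonzero X -> regular_at P f -> regular_at P (X f / X z).
Proof.
move=> F0 zP X0; have [e eP] := laurent_expansion_ex zP.
move=> /(expansion_regular zP eP) pf; apply/(expansion_regular zP eP).
by rewrite (expansion_der_coord F0 eP)//; apply: power_series_ddz.
Qed.

(** * Pseudodifferential operators of nonpositive order *)

Lemma binz0 i : binz i 0 = 1.
Proof. by case: i => n /=; rewrite ?bin0 // addn0 expr0 bin0. Qed.

Lemma binz_pascal i m : binz (i + 1) m.+1 = binz i m.+1 + binz i m.
Proof.
case: i => [n|[|n]].
- by rewrite -PoszD addn1 /= binS PoszD.
- rewrite NegzE addNr /= !add0n !binn !mulr1 exprS mulN1r addNr.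
  by rewrite bin0n.
- have -> : Negz n.+1 + 1 = Negz n by lia.
  rewrite /= !addSn !addnS !exprS !binS !PoszD; ring.
Qed.

Section PsidoMul.
Variables (R : comNzRingType) (d : derivation R).
Implicit Types a b x y : psido d.

Definition der_pow_trunc (U : nat) (i : int) b (k : int) : R :=
  \sum_(m < U) iter m d (pcoef b (k - i + m%:Z)) *~ binz i m.

Lemma der_sum (I : Type) (r : seq I) (G : I -> R) :
  d (\sum_(i <- r) G i) = \sum_(i <- r) d (G i).
Proof. by apply: (big_morph d (derD d)); rewrite der0. Qed.

Lemma derN r : d (- r) = - d r.
Proof. by apply: (addrI (d r)); rewrite -derD !subrr der0. Qed.

Lemma der_mulz r (i : int) : d (r *~ i) = d r *~ i.
Proof.
have pos (n : nat) : d (r *+ n) = d r *+ n.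
  by elim: n => [|n IH]; rewrite ?mulr0n ?der0// !mulrSr derD IH.
case: i => n; first exact: pos.
by rewrite NegzE !mulrNz derN; congr (- _); apply: pos.
Qed.

(** D o (D^i o b) = D^(i + 1) o b, by the Leibniz rule and Pascal's rule. *)
Lemma der_pow_truncS U i b k :
  der_pow_trunc U.+1 (i + 1) b k =
    d (der_pow_trunc U i b k) + der_pow_trunc U.+1 i b (k - 1).
Proof.
rewrite /der_pow_trunc !big_ord_recl /= !binz0 addrCA der_sum -big_split /=.
have E : k - (i + 1) = k - 1 - i by ring.
congr (_ + _); first by rewrite E.
apply: eq_bigr => m _; rewrite /bump leq0n add1n binz_pascal mulrzDr der_mulz addrC E /=.
have -> : k - 1 - i + m.+1%:Z = k - i + m%:Z by rewrite -addn1 PoszD; ring.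
by [].
Qed.

Lemma der_pow_trunc_stable b (N : int) (U V : nat) i k :
  order_le d N b -> N - k + i < U%:Z -> (U <= V)%N ->
  der_pow_trunc U i b k = der_pow_trunc V i b k.
Proof.
move=> bN kU UV; rewrite /der_pow_trunc -(subnKC UV) big_split_ord /=.
rewrite [X in _ = _ + X]big1 ?addr0// => m _.
by rewrite bN ?iter_der0 ?mul0rz//; lia.
Qed.

(** A finite form of the defining sum: only p = M - i and m = i + j - k between 0
    and M + N - k contribute. Both truncations T and U are left free beyond this
    bound, so that sums with different bounds can be compared. *)
Lemma psido_mulE a b (M N k : int) (T U : nat) :
  order_le d M a -> order_le d N b -> M + N - k < T%:Z -> M + N - k < U%:Z ->
  pcoef (psido_mul a b) k =
    \sum_(p < T) pcoef a (M - p%:Z) * der_pow_trunc U (M - p%:Z) b k.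
Proof.
move=> aM bN kT kU; rewrite /= /psido_mul_coef.
pose r := [seq (M - p%:Z, k - (M - p%:Z) + m%:Z) | p <- iota 0 T, m <- iota 0 U].
have rk ij : ij \in r -> k <= ij.1 + ij.2.
  by case/allpairsP => -[p m] [_ _ -> /=]; lia.
rewrite (fsbigE r); first last.
- move=> [i j] /= kij; apply: contraNeq => ne0.
  have iM : i <= M.
    by rewrite leNgt; apply: contraNN ne0 => /aM->; rewrite mul0r mul0rz.
  have jN : j <= N.
    rewrite leNgt; apply: contraNN ne0 => /bN->.
    by rewrite iter_der0 mulr0 mul0rz.
  apply/allpairsP; exists (absz (M - i)%R, absz (i + j - k)%R) => /=.
  have Mi : (absz (M - i)%R)%:Z = M - i by rewrite gez0_abs ?subr_ge0.
  have ijk : (absz (i + j - k)%R)%:Z = i + j - k by rewrite gez0_abs ?subr_ge0.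
  rewrite !mem_iota !add0n !leq0n /= -!ltz_nat Mi ijk; split.
  + apply: le_lt_trans kT; lia.
  + apply: le_lt_trans kU; lia.
  + by congr pair; ring.
- by move=> ij /= /rk.
- apply: allpairs_uniq; rewrite ?iota_uniq//.
  by move=> [p m] [p' m'] _ _ /= [] /addrI /oppr_inj [->] /addrI [->].
rewrite big_seq_cond (eq_bigl (mem r)); last first.
  by move=> ij; apply: andb_idr => /rk kij; apply/mem_set.
rewrite -big_seq big_allpairs_dep -[RHS](big_mkord xpredT (fun p =>
  pcoef a (M - p%:Z) * der_pow_trunc U (M - p%:Z) b k)) /index_iota subn0.
apply: eq_bigr => p _; rewrite /der_pow_trunc mulr_sumr.
rewrite -(big_mkord xpredT (fun m : nat => pcoef a (M - p%:Z) *
  (iter m d (pcoef b (k - (M - p%:Z) + m%:Z)) *~ binz (M - p%:Z) m))).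
rewrite /index_iota subn0; apply: eq_bigr => m _ /=.
have -> : M - p%:Z + (k - (M - p%:Z) + m%:Z) - k = m%:Z by ring.
by rewrite absz_nat mulrzAr.
Qed.

Lemma psido_mul_order a b (M N : int) :
  order_le d M a -> order_le d N b -> order_le d (M + N) (psido_mul a b).
Proof.
move=> aM bN k kMN; rewrite (psido_mulE (M := M) (N := N) (T := 0) (U := 0))//.
- by rewrite big_ord0.
- by rewrite subr_lt0.
- by rewrite subr_lt0.
Qed.

Lemma psido_mono_order r n : order_le d n (psido_mono d r n).
Proof. by move=> i ni /=; case: eqP => // ii; rewrite ii ltxx in ni. Qed.

Lemma psido_monoE r n i : pcoef (psido_mono d r n) i = if i == n then r else 0.
Proof. by []. Qed.

Lemma psido_mul_mono0 r b k : pcoef (psido_mul (psido_mono d r 0) b) k = r * pcoef b k.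
Proof.
have [N bN] := pcoef_bounded b; pose T := (absz (N - k)%R).+1.
have kT : 0 + N - k < T%:Z by rewrite /T; lia.
rewrite (psido_mulE (M := 0) (@psido_mono_order r 0) bN kT kT).
rewrite big_ord_recl big1 ?addr0 => [|p _]; last first.
  have p0 : (0 - (lift ord0 p)%:Z == 0 :> int) = false by rewrite sub0r oppr_eq0.
  by rewrite psido_monoE p0 mul0r.
rewrite psido_monoE eqxx /der_pow_trunc big_ord_recl big1 ?addr0 => [|m _].
  by [].
by rewrite /= bin0n mulr0z.
Qed.

(** Associativity when the left factor is D: the hypothesis says that a' is D o a,
    and the right-hand side is the coefficient of D o (a b). *)
Lemma psido_mul_Dl a a' b k :
  (forall i, pcoef a' i = d (pcoef a i) + pcoef a (i - 1)) ->
  pcoef (psido_mul a' b) k =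
    d (pcoef (psido_mul a b) k) + pcoef (psido_mul a b) (k - 1).
Proof.
move=> a'E; have [M aM] := pcoef_bounded a; have [N bN] := pcoef_bounded b.
have a'M : order_le d (M + 1) a'.
  move=> i iM; rewrite a'E !aM ?der0 ?addr0//; lia.
pose T := (absz (M + 1 + N - k)%R).+1.
have kT : M + 1 + N - k < T%:Z by rewrite /T; lia.
have -> : pcoef (psido_mul a' b) k =
    \sum_(p < T) d (pcoef a (M - p%:Z)) * der_pow_trunc T (M - p%:Z) b k
  + \sum_(p < T) pcoef a (M - p%:Z) * der_pow_trunc T.+1 (M - p%:Z + 1) b k.
  rewrite (psido_mulE (T := T.+1) (U := T.+1) a'M bN); try lia.
  under eq_bigr do rewrite a'E mulrDl.
  rewrite big_split /=; congr (_ + _).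
    rewrite big_ord_recl /= subr0 aM ?der0 ?mul0r ?add0r; last by lia.
    apply: eq_bigr => p _; rewrite /bump leq0n add1n.
    have -> : M + 1 - p.+1%:Z = M - p%:Z by lia.
    by congr (_ * _); apply/esym/(der_pow_trunc_stable (N := N)) => //; lia.
  rewrite big_ord_recr /=.
  have -> : der_pow_trunc T.+1 (M + 1 - T%:Z) b k = 0.
    rewrite -(der_pow_trunc_stable (N := N) (U := 0%N)) ?/der_pow_trunc ?big_ord0//.
    by lia.
  rewrite mulr0 addr0; apply: eq_bigr => p _.
  by have -> : M + 1 - p%:Z = M - p%:Z + 1; [lia|rewrite addrK].
rewrite (psido_mulE (T := T) (U := T) aM bN); try lia.
rewrite (psido_mulE (T := T) (U := T.+1) aM bN); try lia.
rewrite der_sum.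
rewrite [X in _ = X + _](eq_bigr _ (fun p _ => derM d _ _)) big_split -addrA.
congr (_ + _); rewrite -big_split; apply: eq_bigr => p _ /=.
by rewrite der_pow_truncS mulrDr.
Qed.

End PsidoMul.

Section InversePowers.
Variable R : comNzRingType.

(** Coefficient of D^(-j) in (D^-1 f)^n, where D is the symbol of d. Multiplying
    by D on the left turns this power into f (D^-1 f)^(n-1), which is the
    recursion. *)
Fixpoint inv_pow (f : R) (d : derivation R) (n : nat) : nat -> R :=
  if n is n'.+1 then
    fix rec (j : nat) : R :=
      if j is j'.+1 then f * inv_pow f d n' j' - d (rec j') else 0
  else fun j => (j == 0%N)%:R.

Arguments inv_pow : simpl never.

Lemma inv_pow0 f d j : inv_pow f d 0 j = (j == 0%N)%:R.
Proof. by []. Qed.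

Lemma inv_powS0 f d n : inv_pow f d n.+1 0 = 0.
Proof. by []. Qed.

Lemma inv_powSS f d n j :
  inv_pow f d n.+1 j.+1 = f * inv_pow f d n j - d (inv_pow f d n.+1 j).
Proof. by []. Qed.

Lemma inv_pow_lt f d n j : (j < n)%N -> inv_pow f d n j = 0.
Proof.
elim: n j => // n IHn; elim=> // j IHj jn.
by rewrite inv_powSS IHn// IHj ?der0 ?mulr0 ?subr0// ltnW.
Qed.

Lemma inv_pow_diag f d n : inv_pow f d n n = f ^+ n.
Proof.
elim: n => [|n IH]; first by rewrite expr0.
by rewrite inv_powSS IH inv_pow_lt// der0 subr0 exprS.
Qed.

Lemma inv_pow1 (d : derivation R) n j : inv_pow 1 d n j = (n == j)%:R.
Proof.
have d1 : d 1 = 0.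
  by apply: (addrI (d 1)); rewrite addr0 -[in RHS](mulr1 1) derM mulr1 mul1r.
elim: n j => [|n IHn] j; first by rewrite inv_pow0 eq_sym.
elim: j => // j IHj; rewrite inv_powSS IHn IHj mul1r eqSS.
by case: (n.+1 == j); rewrite ?d1 ?der0 subr0.
Qed.

(** Expanding (D2^-1 f)^n in powers of D2, and each D2^-j in powers of D3, gives
    the expansion of (D3^-1 g f)^n, because both satisfy the recursion of
    inv_pow for the derivation d3 = g d2. *)
Lemma inv_pow_comp (f g : R) (d2 d3 : derivation R) n k :
  (forall x, d3 x = g * d2 x) ->
  \sum_(j < k.+1) inv_pow f d2 n j * inv_pow g d3 j k = inv_pow (f * g) d3 n k.
Proof.
move=> d3E; elim: n k => [|n IHn] k.
  rewrite big_ord_recl big1 ?addr0 => [|j _]; last by rewrite inv_pow0 mul0r.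
  by rewrite inv_pow0 mul1r.
elim: k => [|k IHk]; first by rewrite big_ord1 inv_powS0 mul0r.
rewrite inv_powSS -{}IHn -{}IHk big_ord_recl inv_powS0 mul0r add0r.
have E : \sum_(j < k.+1) inv_pow f d2 n.+1 j.+1 * d3 (inv_pow g d3 j.+1 k)
    = \sum_(j < k.+1) inv_pow f d2 n.+1 j * d3 (inv_pow g d3 j k).
  rewrite big_ord_recr [RHS]big_ord_recl /= inv_powS0 mul0r add0r.
  by rewrite [inv_pow g d3 k.+1 k]inv_pow_lt// der0 mulr0 addr0.
rewrite der_sum.
under [X in _ - X]eq_bigr do rewrite derM d3E -mulrA.
rewrite [X in _ - X]big_split -E opprD -!sumrN mulr_sumr -!big_split /=.
apply: eq_bigr => j _; rewrite /bump leq0n add1n !inv_powSS; ring.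
Qed.

Lemma inv_pow_closed (A : set R) f (d : derivation R) n j :
  A 0 -> A 1 -> (forall x y, A x -> A y -> A (x - y)) ->
  (forall x y, A x -> A y -> A (x * y)) -> (forall x, A x -> A (d x)) ->
  A f -> A (inv_pow f d n j).
Proof.
move=> A0 A1 AB AM Ad Af; elim: n j => [|n IHn] j.
  by rewrite inv_pow0; case: (j == 0%N).
by elim: j => // j IHj; rewrite inv_powSS; apply: AB; [apply: AM|apply: Ad].
Qed.

End InversePowers.
Arguments inv_pow : simpl never.

Lemma inv_pow_map (R S : comNzRingType) (e : {rmorphism R -> S}) f
    (d : derivation R) (d' : derivation S) n j :
  (forall x, e (d x) = d' (e x)) ->
  e (inv_pow f d n j) = inv_pow (e f) d' n j.
Proof.
move=> ed; elim: n j => [|n IHn] j; first by rewrite !inv_pow0 rmorph_nat.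
elim: j => [|j IHj]; first by rewrite !inv_powS0 rmorph0.
by rewrite !inv_powSS rmorphB rmorphM ed IHn IHj.
Qed.

Section NonpositiveOrder.
Variable R : comNzRingType.
Implicit Types d : derivation R.

Definition ncoef d (a : psido d) (n : nat) : R := pcoef a (- n%:Z).

Lemma psido_le0_eq d (a b : psido d) : order_le d 0 a -> order_le d 0 b ->
  (forall n, ncoef a n = ncoef b n) -> a = b.
Proof.
move=> a0 b0 ab; apply: psidoP => i; have [i0|i0] := ltP 0 i.
  by rewrite a0// b0.
have := ab (absz i); rewrite /ncoef.
by have -> : - (absz i)%:Z = i by lia.
Qed.

End NonpositiveOrder.

Section ChangeOfDerivation.
Variable R : comUnitRingType.
Implicit Types (f g : R) (d : derivation R).

(** Left multiplication by D determines an operator of bounded order, and it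
    carries D^-1 f w to f w. *)
Lemma psido_powE f d n :
  order_le d (- n%:Z) (psido_pow f d (- n%:Z)) /\
  forall j, ncoef (psido_pow f d (- n%:Z)) j = inv_pow f d n j.
Proof.
pose b := psido_mul (psido_mono d 1 (-1)) (psido_mono d f 0).
have d1 : d 1 = 0.
  by apply: (addrI (d 1)); rewrite addr0 -[in RHS](mulr1 1) derM mulr1 mul1r.
have bE k : pcoef (psido_mono d f 0) k = d (pcoef b k) + pcoef b (k - 1).
  rewrite -(psido_mul_Dl (a' := psido_mono d 1 0)).
    by rewrite psido_mul_mono0 mul1r.
  move=> i; rewrite !psido_monoE.
  have -> : (i - 1 == -1) = (i == 0) by lia.
  by case: (i == -1); rewrite ?d1 ?der0 add0r.
have b1 : order_le d (-1) b.
  by have := psido_mul_order (@psido_mono_order _ d 1 (-1)) (@psido_mono_order _ d f 0).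
have powS m : psido_pow f d (- m.+1%:Z) = psido_mul b (psido_pow f d (- m%:Z)).
  by case: m.
elim: n => [|n [IHo IHc]].
  split; first exact: psido_mono_order.
  by move=> j; rewrite /ncoef psido_monoE oppr_eq0; case: j.
rewrite powS; have oS : order_le d (- n.+1%:Z) (psido_mul b (psido_pow f d (- n%:Z))).
  have -> : - n.+1%:Z = -1 + - n%:Z by lia.
  exact: psido_mul_order.
split=> //; elim=> [|j IHj]; first by rewrite /ncoef oS.
rewrite inv_powSS -IHc -IHj /ncoef.
have -> : - j.+1%:Z = - j%:Z - 1 by lia.
apply: (addrI (d (ncoef (psido_mul b (psido_pow f d (- n%:Z))) j))).
by rewrite -(psido_mul_Dl _ _ bE) psido_mul_mono0 addrCA subrr addr0.
Qed.

Lemma change_der_le0 f d2 d1 (a : psido d1) : order_le d1 0 a ->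
  order_le d2 0 (change_der f d2 a).
Proof.
move=> a0 k k0; apply: fsbig1 => i /= ki.
by rewrite a0 ?mul0r//; apply: lt_le_trans k0 ki.
Qed.

Lemma change_derE f d2 d1 (a : psido d1) k : order_le d1 0 a ->
  ncoef (change_der f d2 a) k = \sum_(n < k.+1) ncoef a n * inv_pow f d2 n k.
Proof.
move=> a0; rewrite /ncoef /=.
pose r := [seq - n%:Z | n <- iota 0 k.+1].
rewrite (fsbigE r); first last.
- move=> i /= ki; apply: contraNeq => ne0.
  have i0 : i <= 0 by rewrite leNgt; apply: contraNN ne0 => /a0->; rewrite mul0r.
  apply/mapP; exists (absz i); last by lia.
  by rewrite mem_iota; lia.
- by move=> i /= /mapP[n]; rewrite mem_iota => nk ->; lia.
- by rewrite map_inj_uniq ?iota_uniq// => x y; lia.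
rewrite big_map.
rewrite big_seq_cond (eq_bigl (mem (iota 0 k.+1))); last first.
  by move=> n; apply: andb_idr; rewrite mem_iota => nk; apply/mem_set => /=; lia.
rewrite -big_seq -[RHS](big_mkord xpredT (fun n => pcoef a (- n%:Z) * inv_pow f d2 n k)).
rewrite /index_iota subn0; apply: eq_bigr => n _.
by have [_ <-] := psido_powE f d2 n.
Qed.

Lemma change_der_comp f g d2 d3 d1 (a : psido d1) : order_le d1 0 a ->
  (forall x, d3 x = g * d2 x) ->
  change_der g d3 (change_der f d2 a) = change_der (f * g) d3 a.
Proof.
move=> a0 d3E; have ca0 := change_der_le0 f d2 a0.
apply: psido_le0_eq; [exact: change_der_le0|exact: change_der_le0|move=> k].
rewrite !change_derE//.
under eq_bigr do rewrite change_derE// mulr_suml.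
under [RHS]eq_bigr do rewrite -(inv_pow_comp _ _ _ d3E) mulr_sumr.
rewrite (eq_bigr (fun j : 'I_k.+1 => \sum_(n < k.+1)
  ncoef a n * inv_pow f d2 n j * inv_pow g d3 j k)) => [|j _].
  by rewrite exchange_big; apply: eq_bigr => n _; apply: eq_bigr => j _; rewrite mulrA.
rewrite (big_ord_widen k.+1 (fun n => ncoef a n * inv_pow f d2 n j * inv_pow g d3 j k))//.
rewrite big_mkcond; apply: eq_bigr => n _; case: ltnP => // jn.
by rewrite inv_pow_lt ?mulr0 ?mul0r.
Qed.

Lemma change_der1 d1 (a : psido d1) : order_le d1 0 a -> change_der 1 d1 a = a.
Proof.
move=> a0; apply: psido_le0_eq => // [|k]; first exact: change_der_le0.
rewrite change_derE// big_ord_recr /= big1 => [|n _].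
  by rewrite add0r inv_pow1 eqxx mulr1.
by rewrite inv_pow1 (ltn_eqF (ltn_ord n)) mulr0.
Qed.

Lemma change_der_lead f d2 d1 (a : psido d1) n : order_le d1 0 a ->
  order_le d1 (- n%:Z) a -> ncoef (change_der f d2 a) n = ncoef a n * f ^+ n.
Proof.
move=> a0 an; rewrite change_derE// big_ord_recr /= big1 => [|m _].
  by rewrite add0r inv_pow_diag.
rewrite {1}/ncoef an ?mul0r//.
have := ltn_ord m; lia.
Qed.

(** Only f occurs in the recursion, not f^-1: the derivation f^-1 d2, from which
    one starts, need not preserve A. *)
Lemma change_der_closed (A : set R) f d2 d1 (a : psido d1) :
  A 0 -> A 1 -> (forall x y, A x -> A y -> A (x - y)) ->
  (forall x y, A x -> A y -> A (x * y)) -> (forall x, A x -> A (d2 x)) ->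
  order_le d1 0 a -> A f -> (forall n, A (ncoef a n)) ->
  forall n, A (ncoef (change_der f d2 a) n).
Proof.
move=> A0 A1 AB AM Ad a0 Af Aa n; rewrite change_derE//.
have AD x y : A x -> A y -> A (x + y).
  by move=> Ax Ay; rewrite -[y]opprK -[- y]sub0r; apply: (AB) => //; apply: (AB).
apply: (big_ind A) => // m _; apply: (AM) => //.
exact: (inv_pow_closed (A := A)).
Qed.

End ChangeOfDerivation.

Section PsidoMap.
Variables (R S : comNzRingType) (e : {rmorphism R -> S}).
Variables (d : derivation R) (d' : derivation S).
Hypothesis ed : forall x, e (d x) = d' (e x).
Implicit Types a b : psido d.

Lemma psido_map_order a (N : int) : order_le d N a -> order_le d' N (psido_map e d' a).
Proof. by move=> aN i /aN; rewrite /= => ->; rewrite rmorph0. Qed.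

Lemma psido_map_add a b :
  psido_map e d' (psido_add a b) = psido_add (psido_map e d' a) (psido_map e d' b).
Proof. by apply: psidoP => i /=; rewrite rmorphD. Qed.

Lemma psido_map_scale r a :
  psido_map e d' (psido_scale r a) = psido_scale (e r) (psido_map e d' a).
Proof. by apply: psidoP => i /=; rewrite rmorphM. Qed.

Lemma psido_map_one : psido_map e d' (psido_one d) = psido_one d'.
Proof. by apply: psidoP => i /=; case: eqP; rewrite ?rmorph1 ?rmorph0. Qed.

Lemma iter_der_map m x : e (iter m d x) = iter m d' (e x).
Proof. by elim: m => //= m IH; rewrite ed IH. Qed.

Lemma psido_map_mul a b :
  psido_map e d' (psido_mul a b) = psido_mul (psido_map e d' a) (psido_map e d' b).
Proof.
apply: psidoP => k; have [M aM] := pcoef_bounded a; have [N bN] := pcoef_bounded b.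
pose T := (absz (M + N - k)%R).+1; have kT : M + N - k < T%:Z by rewrite /T; lia.
rewrite (psido_mulE (psido_map_order aM) (psido_map_order bN) kT kT).
transitivity (e (pcoef (psido_mul a b) k)) => //.
rewrite (psido_mulE aM bN kT kT) rmorph_sum; apply: eq_bigr => p _.
rewrite rmorphM rmorph_sum; congr (_ * _); apply: eq_bigr => m _.
by rewrite rmorphMz iter_der_map.
Qed.

End PsidoMap.

Lemma psido_map_change_der (R S : comUnitRingType) (e : {rmorphism R -> S})
    (d1 d2 : derivation R) (d1' d2' : derivation S) f (a : psido d1) :
  (forall x, e (d2 x) = d2' (e x)) -> order_le d1 0 a ->
  psido_map e d2' (change_der f d2 a) = change_der (e f) d2' (psido_map e d1' a).
Proof.
move=> ed a0; have ea0 := psido_map_order e d1' a0.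
apply: psido_le0_eq; [exact/psido_map_order/change_der_le0|exact: change_der_le0|].
move=> k; rewrite change_derE// -[LHS]/(e (ncoef (change_der f d2 a) k)).
rewrite change_derE// rmorph_sum; apply: eq_bigr => n _.
by rewrite rmorphM (inv_pow_map _ _ _ ed).
Qed.

(** * Local conditions on pseudodifferential operators *)

Section LocalConditions.
Variables (F : fieldType) (C : curve F).
Hypothesis F0 : [pchar F] =i pred0.
Implicit Types (P : cpoint C) (X : vfield C).

(** The factor carrying X to the derivation z^delta d/dz. *)
Definition coord_factor X (z : C) (delta : int) : C := z ^ delta / X z.

Definition coord_der X (z : C) (delta : int) : derivation C :=
  scale_der (coord_factor X z delta) X.

Definition in_coord X (z : C) (delta : int) (a : psido X) :
    psido (coord_der X z delta) :=
  change_der (coord_factor X z delta) (coord_der X z delta) a.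

(** The passage to z^delta d/dz takes place over the function field, and Laurent
    expansion preserves and detects regularity; so the condition on Laurent
    expansions is a condition on rational functions. *)
Lemma local_psidoP P z (e : {rmorphism C -> laurent F}) X delta (a : psido X) :
  local_coordinate P z -> laurent_expansion P z e -> vfield_nonzero X ->
  order_le X 0 a ->
  local_psido delta (expand z e a) <->
    forall n, regular_at P (ncoef (in_coord z delta a) n).
Proof.
move=> zP eP X0 a0; have Xz := vfield_coord_neq0 F0 zP X0.
have XzU : e (X z) \is a GRing.unit by apply: expansion_unit.
pose dz := scale_der (laurent_mono 1 delta) (ddz F).
have eder x : e (coord_der X z delta x) = dz (e x).
  rewrite /= /coord_factor rmorphM (expansion_der F0 eP X x) mulrA -rmorphM divfK//.
  by rewrite (expansion_coordX zP eP).
have efac : e (coord_factor X z delta) * laurent_mono 1 (- delta) = (e (X z))^-1.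
  rewrite rmorphM rmorphV ?unitfE// (expansion_coordX zP eP) mulrAC.
  by rewrite laurent_mono_mul mulr1 subrr mul1r.
have dzV x : ddz F x = laurent_mono 1 (- delta) * dz x.
  by rewrite /= mulrA laurent_mono_mul mulr1 addNr mul1r.
pose a1 := in_coord z delta a; pose ea1 := psido_map e dz a1.
have a10 : order_le _ 0 a1 by apply: change_der_le0.
have ea10 : order_le _ 0 ea1 by apply: psido_map_order.
have E : expand z e a = change_der (laurent_mono 1 (- delta)) (ddz F) ea1.
  rewrite /ea1 /a1 /in_coord.
  rewrite (@psido_map_change_der _ _ e _ _ (scale_der (e (X z)) (ddz F)) _ _ _ eder a0).
  by rewrite (change_der_comp _ _ dzV) ?efac//; apply: psido_map_order.
have back (c : psido dz) : order_le _ 0 c ->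
    change_der (laurent_mono 1 delta) dz
      (change_der (laurent_mono 1 (- delta)) (ddz F) c) = c.
  move=> c0; rewrite change_der_comp// laurent_mono_mul mulr1 addNr.
  exact: (change_der1 c0).
split=> [[c [c0 cps]]|reg].
  rewrite E => /(congr1 (change_der (laurent_mono 1 delta) dz)).
  rewrite !back// => ec n; apply/(expansion_regular zP eP).
  rewrite -[e _]/(pcoef ea1 (- n%:Z)) ec; exact: cps.
exists ea1; split=> // i; have [i0|i0] := ltP 0 i.
  by rewrite ea10// => k _ /=; rewrite if_same.
have -> : i = - (absz i)%:Z by lia.
by apply/(expansion_regular zP eP)/reg.
Qed.

Lemma BdivP X (z : cpoint C -> C) (D : cpoint C -> int) (a : psido X) :
  (forall P, local_coordinate P (z P)) -> vfield_nonzero X ->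
  Bdiv z D a <-> order_le X 0 a /\
    forall P n, regular_at P (ncoef (in_coord (z P) (D P) a) n).
Proof.
move=> zP X0; split=> -[a0 aP]; split=> // P.
  have [e eP] := aP P.
  by rewrite (local_psidoP (D P) (zP P) eP X0 a0).
have [e eP] := laurent_expansion_ex (zP P); exists e => //.
by apply/(local_psidoP (D P) (zP P) eP X0 a0).
Qed.

End LocalConditions.

(** * Ramification *)

Lemma derX (R : comNzRingType) (d : derivation R) x n :
  d (x ^+ n.+1) = n.+1%:R * x ^+ n * d x.
Proof.
elim: n => [|n IH]; first by rewrite expr0 expr1 !mul1r.
by rewrite exprS derM IH -[in RHS]addn1 natrD exprS; ring.
Qed.

Section Ramification.
Variables (F : fieldType) (C C' : curve F) (phi : covering C C').
Hypothesis F0 : [pchar F] =i pred0.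
Local Notation pb := (cov_pb phi).

Lemma cov_regular P f : regular_at (phi P) f -> regular_at P (pb f).
Proof. by case=> c /cov_value fc; exists c. Qed.

Section AtPoint.
Variables (P : cpoint C) (z : C) (z' : C').
Hypotheses (zP : local_coordinate P z) (z'P : local_coordinate (phi P) z').

Lemma pb_coord_neq0 : pb z' != 0.
Proof. by rewrite fmorph_eq0 (coord_neq0 z'P). Qed.

Lemma ram_indexP : exists n u c, [/\ ram_index phi P = n.+1,
  has_value P u c, c != 0 & pb z' = u * z ^+ n.+1].
Proof.
have z'0 := cov_value (coord_value0 z'P).
have [n [u [c [uc c0 E]]]] :=
  regular_order zP (regular_value z'0) pb_coord_neq0.
have : exists n, exists (z : C) (z' : C') (u : C) (c : F),
    [/\ local_coordinate P z, local_coordinate (phi P) z',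
        has_value P u c, c != 0 & pb z' = u * z ^+ n].
  by exists n, z, z', u, c.
move=> /(@xgetPex _ 0%N) /=; rewrite -/(ram_index phi P).
move: (ram_index phi P) => {n u c uc c0 E} r.
case=> [z1 [z1' [u [c [z1P z1'P uc c0 E]]]]].
have [v [b [vb b0 z1E]]] := coord_quotient z1P zP.
have [v' [b' [vb' b0' z1E']]] := coord_quotient z1'P z'P.
have vb'P := cov_value vb'.
have w : has_value P (u * v ^+ r / pb v') (c * b ^+ r / b').
  by apply: has_valueM; [apply/has_valueM/has_valueX|apply: has_valueV].
have w0 : c * b ^+ r / b' != 0 by rewrite !mulf_neq0 ?expf_neq0 ?invr_eq0.
have {}E : pb z' = u * v ^+ r / pb v' * z ^+ r.
  move: E; rewrite z1E z1E' rmorphM exprMn => E.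
  have pv0 := has_value_neq0 b0' vb'P.
  by apply: (mulfI pv0); rewrite E; field.
case: (r) w w0 E => [|n] w w0 E; last by do 3!eexists; split; eauto.
move: z'0; rewrite E [z ^+ 0]expr0 mulr1 => /(has_value_uniq w) c00.
by rewrite c00 eqxx in w0.
Qed.

(** From pb z' = u z^nu, the derivative d(pb z')/dz is z^(nu - 1) times the
    regular function nu u + z du/dz. *)
Lemma ram_der_regular (X : vfield C) : vfield_nonzero X ->
  regular_at P (X (pb z') / X z * z ^ (1 - (ram_index phi P)%:Z)).
Proof.
move=> X0; have [n [u [c [-> uc c0 ->]]]] := ram_indexP.
have z0 := coord_neq0 zP; have Xz := vfield_coord_neq0 F0 zP X0.
have -> : 1 - n.+1%:Z = - n%:Z by lia.
have -> : X (u * z ^+ n.+1) / X z * z ^ (- n%:Z) = X u / X z * z + n.+1%:R * u.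
  rewrite derM derX -invr_expz -exprnP exprS; field.
  by rewrite Xz expf_neq0.
apply: regularD; apply: regularM.
- exact/(der_coord_regular F0 zP)/regular_value/uc.
- exact: coord_regular.
- exact: regular_nat.
- exact: regular_value uc.
Qed.

(** The comparison of z'^delta' d/dz' and z^delta d/dz: the exponents in
    pullback_div are those for which the quotient is a unit. *)
Lemma ram_factor_regular (X : vfield C) (delta delta' : int) : vfield_nonzero X ->
  delta' * (ram_index phi P)%:Z + (1 - (ram_index phi P)%:Z) <= delta ->
  regular_at P (z ^ delta * pb z' ^ (- delta') * (X (pb z') / X z)).
Proof.
move=> X0 le_delta; have := ram_der_regular X0.
have [n [u [c [nE uc c0 zE]]]] := ram_indexP.
have z0 := coord_neq0 zP.
have u0 := has_value_neq0 c0 uc.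
move: (X (pb z') / X z) => r; set nu := ram_index phi P in le_delta nE *.
move=> rreg; pose m := delta - (delta' * nu%:Z + (1 - nu%:Z)).
have -> : z ^ delta * pb z' ^ (- delta') * r =
    z ^+ absz m * u ^ (- delta') * (r * z ^ (1 - nu%:Z)).
  have -> : z ^ delta = z ^+ absz m * z ^ (delta' * nu%:Z) * z ^ (1 - nu%:Z).
    by rewrite exprnP -!expfzDr//; congr (_ ^ _); rewrite /m; lia.
  have -> : pb z' ^ (- delta') = u ^ (- delta') * z ^ (- (delta' * nu%:Z)).
    rewrite zE -nE expfzMl; congr (_ * _).
    by rewrite exprnP exprz_exp mulrN mulrC.
  have E : z ^ (delta' * nu%:Z) * z ^ (- (delta' * nu%:Z)) = 1.
    by rewrite -expfzDr// subrr expr0z.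
  move: (z ^+ absz m) (z ^ (delta' * nu%:Z)) (z ^ (1 - nu%:Z)) (u ^ _)
    (z ^ (- (delta' * nu%:Z))) E.
  move=> x1 x2 x3 x4 x5 E; transitivity (x1 * x4 * (r * x3) * (x2 * x5)).
    by ring.
  by rewrite E mulr1.
apply: regularM => //; apply: regularM; first exact/regularX/(coord_regular zP).
case: delta' {le_delta m} => k.
  case: k => [|k]; first by rewrite oppr0 expr0z; apply: regular1.
  rewrite -invr_expz -exprnP -exprVn; apply/regularX; exists c^-1.
  exact: has_valueV.
by rewrite NegzE opprK -exprnP; apply/regularX/(regular_value uc).
Qed.

End AtPoint.
End Ramification.

(** * Pull-back of pseudodifferential operators *)

Section Pullback.
Variables (F : fieldType) (C C' : curve F) (phi : covering C C').
Hypothesis F0 : [pchar F] =i pred0.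
Local Notation pb := (cov_pb phi).
Variables (X' : vfield C') (X : vfield C).
Hypotheses (X'0 : vfield_nonzero X') (X0 : vfield_nonzero X).
Hypothesis pbX : forall f, pb (X' f) = X (pb f).
Variables (z : cpoint C -> C) (z' : cpoint C' -> C').
Hypothesis zP : forall P, local_coordinate P (z P).
Hypothesis z'P : forall P', local_coordinate P' (z' P').
Variables (D' : cpoint C' -> int) (D : cpoint C -> int).
Hypothesis D0 : effective D.
Hypothesis leD : forall P, pullback_div phi D' P <= D P.

Lemma pullback_factor_regular P :
  regular_at P (coord_factor X (z P) (D P)
    / pb (coord_factor X' (z' (phi P)) (D' (phi P)))).
Proof.
have := ram_factor_regular F0 (zP P) (z'P (phi P)) X0 (leD P).
congr regular_at; rewrite /coord_factor rmorphM fmorphV pbX.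
rewrite rmorphXz ?unitfE ?(coord_neq0 (z'P _))//.
rewrite invfM invrK -invr_expz.
by move: (_ ^ _) (_ ^ _)^-1 (X _) (X _)^-1 => x1 x2 x3 x4; ring.
Qed.

Lemma coord_der_regular P f : regular_at P f ->
  regular_at P (coord_der X (z P) (D P) f).
Proof.
move=> rf; have := der_coord_regular F0 (zP P) X0 rf.
rewrite /= /coord_factor -mulrA [_^-1 * _]mulrC; apply: regularM.
by have := D0 P; case: (D P) => // n _; apply/regularX/(coord_regular (zP P)).
Qed.

(** The change of derivation commutes with the pull-back. This expresses the
    pulled-back operator, with regular coefficients, in the lift of
    z'^delta' d/dz'; one more change of derivation, with a regular factor, leads
    to z^delta d/dz. *)
Lemma pullback_Bdiv (a : psido X') : Bdiv z' D' a -> Bdiv z D (psido_map pb X a).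
Proof.
move/(BdivP F0 _ _ z'P X'0) => [a0 areg]; apply/(BdivP F0 _ _ zP X0).
have b0 : order_le X 0 (psido_map pb X a) by apply: psido_map_order.
split=> // P.
set f := coord_factor X (z P) (D P).
set f' := coord_factor X' (z' (phi P)) (D' (phi P)).
have f'0 : pb f' != 0.
  rewrite fmorph_eq0 mulf_neq0 ?invr_eq0 ?(vfield_coord_neq0 F0 (z'P _))//.
  by rewrite expfz_neq0// (coord_neq0 (z'P _)).
pose dphi := scale_der (pb f') X.
have fE : pb f' * (f / pb f') = f by rewrite mulrC divfK.
have dE x : coord_der X (z P) (D P) x = f / pb f' * dphi x.
  by rewrite /= -/f mulrA divfK.
have derE x : pb (coord_der X' (z' (phi P)) (D' (phi P)) x) = dphi (pb x).
  by rewrite /= rmorphM pbX.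
have -> : in_coord (z P) (D P) (psido_map pb X a) =
    change_der (f / pb f') (coord_der X (z P) (D P))
      (psido_map pb dphi (in_coord (z' (phi P)) (D' (phi P)) a)).
  rewrite /in_coord (@psido_map_change_der _ _ pb _ _ X _ _ _ derE a0).
  by rewrite (change_der_comp _ b0 dE) fE.
apply: (change_der_closed (A := regular_at P)).
- exact: regular0.
- exact: regular1.
- exact: regularB.
- exact: regularM.
- exact: coord_der_regular.
- exact/psido_map_order/change_der_le0.
- exact: pullback_factor_regular.
- by move=> n; apply/cov_regular/areg.
Qed.

Lemma filtered_morphism_restrict (B' : set (psido X')) (B : set (psido X)) :
  (forall a, B' a -> B (psido_map pb X a)) ->
  filtered_morphism B' B (psido_map pb X).
Proof.
move=> BB; split=> // [|a b _ _|a b _ _|].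
- exact: psido_map_one.
- exact: psido_map_add.
- exact: (psido_map_mul pbX).
- split=> [c a _|i a _]; first by rewrite psido_map_scale cov_cst.
  exact: psido_map_order.
Qed.

End Pullback.

(** * Symbols *)

Section VectorFields.
Variables (F : fieldType) (C : curve F).
Hypothesis F0 : [pchar F] =i pred0.
Implicit Types (X Y : vfield C).

Lemma vfield_proportional X Y f t : Y f * X t = Y t * X f.
Proof.
have der Z : der_along idfun (Z : vfield C).
  by split=> [x y|x y|c]; [apply: derD|apply: derM|apply: vfield_cst].
exact: (der_along_proportional f t F0 (der Y) (der X)).
Qed.

Lemma inv_vfieldP X Y f : vfield_nonzero X -> Y f = inv_vfield X Y * X f.
Proof.
move=> [t Xt].
have : exists r, forall f, Y f = r * X f.
  exists (Y t / X t) => g; apply: (mulIf Xt); rewrite mulrAC divfK//.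
  exact: vfield_proportional.
by move=> /(@xgetPex _ 0 [set r | forall f, Y f = r * X f]); apply.
Qed.

Lemma inv_vfieldE X Y t : X t != 0 -> inv_vfield X Y = Y t / X t.
Proof.
by move=> Xt; rewrite (@inv_vfieldP X Y t) ?mulfK//; exists t.
Qed.

Lemma symb_dpow X (a : psido X) i t : X t != 0 ->
  symb i a = dpow (ncoef a i / X t ^+ i) t i.
Proof.
move=> Xt; apply/funext => Y; rewrite /symb /dpow (inv_vfieldE _ Xt) expr_div_n.
by rewrite mulrA mulrAC.
Qed.

(** The change to z^delta d/dz multiplies the coefficient of order -i by the
    i-th power of z^delta / X z, and the coefficients so obtained are regular. *)
Lemma symb_H0 X (z : cpoint C -> C) (D : cpoint C -> int) i (a : psido X) :
  (forall P, local_coordinate P (z P)) -> vfield_nonzero X ->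
  Bdiv z D a -> order_le X (- i%:Z) a -> H0 D i (symb i a).
Proof.
move=> zP X0 /(BdivP F0 _ _ zP X0)[a0 areg] ai P z1 z1P.
have Xz1 := vfield_coord_neq0 F0 z1P X0.
have Xz := vfield_coord_neq0 F0 (zP P) X0.
exists (ncoef a i / X z1 ^+ i); last exact: symb_dpow.
have := areg P i; rewrite /in_coord change_der_lead// => reg.
have [v [b [vb b0 z1E]]] := coord_quotient z1P (zP P).
have v0 := has_value_neq0 b0 vb.
have -> : ncoef a i / X z1 ^+ i * z1 ^ (i%:Z * D P) =
    ncoef a i * coord_factor X (z P) (D P) ^+ i * (v ^ D P * (X (z P) / X z1)) ^+ i.
  rewrite -mulrA -mulrA -exprMn; congr (_ * _).
  rewrite [_ * D P]mulrC -exprz_exp -exprnP -exprVn -exprMn; congr (_ ^+ _).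
  rewrite {2}z1E /coord_factor expfzMl.
  move: (X (z P)) (X z1) (v ^ _) (z P ^ _) Xz Xz1 => x1 x2 x3 x4 x10 x20.
  by field; rewrite x10 x20.
apply: regularM => //; apply: regularX; apply: regularM.
  case: (D P) => k; first exact/regularX/(regular_value vb).
  rewrite NegzE -invr_expz -exprnP -exprVn; apply/regularX; exists b^-1.
  exact: has_valueV.
exact/(der_coord_regular F0 z1P)/coord_regular.
Qed.

End VectorFields.

Section PullbackForms.
Variables (F : fieldType) (C C' : curve F) (phi : covering C C').
Hypothesis F0 : [pchar F] =i pred0.
Local Notation pb := (cov_pb phi).
Variables (X' : vfield C') (X : vfield C).
Hypotheses (X'0 : vfield_nonzero X') (X0 : vfield_nonzero X).
Hypothesis pbX : forall f, pb (X' f) = X (pb f).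

(** A homogeneous function of degree i on the line of vector fields is
    determined by its value on one of them. *)
Lemma pullbackE i f g :
  pullback phi i (dpow f g i) =
    fun Y => inv_vfield X Y ^+ i * pb (dpow f g i X').
Proof.
have : exists w, exists f0 g0, dpow f g i = dpow f0 g0 i /\
    w = dpow (pb f0) (pb g0) i by exists (dpow (pb f) (pb g) i), f, g.
move=> /(@xgetPex _ (fun=> 0)) /=; rewrite -/(pullback phi i _) => -[f0 [g0 [E ->]]].
apply/funext => Y; rewrite E /dpow rmorphM rmorphXn pbX.
by rewrite (inv_vfieldP F0 Y (pb g0) X0) exprMn mulrCA.
Qed.

Variables (z' : cpoint C' -> C').
Hypothesis z'P : forall P', local_coordinate P' (z' P').
Variables (D' : cpoint C' -> int) (D : cpoint C -> int).
Hypothesis leD : forall P, pullback_div phi D' P <= D P.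

Lemma pullback_H0 i w : H0 D' i w -> H0 D i (pullback phi i w).
Proof.
move=> wH P z zP; set z1 := z' (phi P).
have [h hreg wE] := wH (phi P) _ (z'P (phi P)).
have Xz := vfield_coord_neq0 F0 zP X0.
exists (pb h * (X (pb z1) / X z) ^+ i); last first.
  rewrite wE pullbackE; apply/funext => Y; rewrite (inv_vfieldE F0 _ Xz) /dpow.
  rewrite rmorphM rmorphXn -/z1 pbX !exprMn; ring.
have reg := ram_factor_regular F0 zP (z'P (phi P)) X0 (leD P).
have pz1 : pb z1 != 0 by rewrite fmorph_eq0 (coord_neq0 (z'P (phi P))).
have -> : pb h * (X (pb z1) / X z) ^+ i * z ^ (i%:Z * D P) =
    pb (h * z1 ^ (i%:Z * D' (phi P))) *
    (z ^ D P * pb z1 ^ (- D' (phi P)) * (X (pb z1) / X z)) ^+ i.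
  rewrite rmorphM rmorphXz ?unitfE ?(coord_neq0 (z'P _))//.
  rewrite -!mulrA; congr (_ * _).
  rewrite ![i%:Z * _]mulrC -!exprz_exp -!exprnP -!exprMn; congr (_ ^+ _).
  rewrite -invr_expz; have := expfz_neq0 (D' (phi P)) pz1.
  move: (pb z1 ^ _) (X _) (X _)^-1 (z ^ _) => x1 x2 x3 x4 x10.
  by field.
apply: regularM; [exact: cov_regular|exact: regularX].
Qed.

Lemma pullback_symb i (a : psido X') :
  symb i (psido_map pb X a) = pullback phi i (symb i a).
Proof.
have [t Xt] := X'0; rewrite (symb_dpow _ _ _ Xt)// pullbackE -(symb_dpow _ _ _ Xt)//.
apply/funext => Y; rewrite /symb (inv_vfieldE F0 _ Xt) divff// expr1n mulr1.
by rewrite mulrC.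
Qed.

End PullbackForms.

(** * The lift of a vector field along a covering *)

(** On a curve without points every function on the vector fields would be a
    regular differential, and the function field would be finite dimensional
    over the constants. *)
Lemma genus_point (F : fieldType) (C : curve F) g :
  has_genus C g -> exists P : cpoint C, True.
Proof.
move=> [b _ bP]; apply: contrapT => noP.
have span f : exists c : {ffun 'I_g -> F},
    f = \sum_j curve_cst C (c j) * b j (zero_vfield C).
  have wH : H0 (zero_div C) 1 (fun=> f) by move=> P; case: noP; exists P.
  have [c [cE _]] := bP _ wH; exists c.
  exact: (congr1 (fun w : differential C => w (zero_vfield C)) cE).
have [t] := curve_transc C; apply.
have [c cE] := choice (fun k : 'I_g.+1 => span (t ^+ k)).
pose M : 'M[F]_(g.+1, g) := \matrix_(k, j) c k j.
have : kermx M != 0.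
  rewrite kermx_eq0 /row_free; apply/eqP => rM.
  by have := rank_leq_col M; rewrite rM ltnn.
case/rowV0Pn => u /sub_kermxP uM u0.
pose p : {poly F} := \poly_(k < g.+1) u 0 (inord k).
have pE (k : 'I_g.+1) : p`_k = u 0 k by rewrite coef_poly ltn_ord inord_val.
exists p.
  apply: contraNneq u0 => p0; apply/eqP/rowP => k; rewrite mxE -pE p0.
  by rewrite coef0.
rewrite rootE (horner_coef_wide (n := g.+1)); last first.
  by rewrite size_map_poly size_poly.
under eq_bigr => k _ do rewrite coef_map /= pE cE mulr_sumr.
rewrite exchange_big big1//= => j _.
have := congr1 (fun v : 'rV_g => curve_cst C (v 0 j)) uM.
rewrite !mxE rmorph_sum rmorph0 => E.
transitivity ((\sum_k curve_cst C (u 0 k * M k j)) * b j (zero_vfield C)).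
  by rewrite mulr_suml; apply: eq_bigr => k _; rewrite mxE rmorphM mulrA.
by rewrite E mul0r.
Qed.

Lemma ddz_eq0 (F : fieldType) (s : laurent F) : [pchar F] =i pred0 ->
  ddz F s = 0 -> s = laurent_mono (s 0) 0.
Proof.
move=> F0 ds; apply: laurentP => k /=; case: eqP => [->//|/eqP k0].
have := congr1 (fun f : laurent F => f (k - 1)) ds; rewrite /= if_same subrK.
have nz (n : nat) (x : F) : n != 0%N -> x *+ n = 0 -> x = 0.
  move=> n0 /eqP; rewrite -mulr_natr mulf_eq0 ((pcharf0P F).1 F0) (negPf n0) orbF.
  by move/eqP.
case: k k0 => n n0; first exact: nz.
by rewrite NegzE mulrNz => /eqP; rewrite oppr_eq0 => /eqP; apply: nz.
Qed.

Section LiftVectorField.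
Variables (F : fieldType) (C C' : curve F) (phi : covering C C').
Hypothesis F0 : [pchar F] =i pred0.
Local Notation pb := (cov_pb phi).

Lemma scale_vfield_cst (f : C) (X : vfield C) c : scale_der f X (curve_cst C c) = 0.
Proof. by rewrite /= vfield_cst mulr0. Qed.

(** A function pulled back from C' that d/dz kills has a constant Laurent
    expansion, so it is a constant, and every vector field of C' kills it. *)
Lemma vfield_pb_neq0 (P : cpoint C) z (X : vfield C) (X' : vfield C') f :
  local_coordinate P z -> vfield_nonzero X -> X' f != 0 -> X (pb f) != 0.
Proof.
move=> zP X0; apply: contra_neq => Xf.
have [e eP] := laurent_expansion_ex zP; have [ec _ _] := eP.
have : ddz F (e (pb f)) = 0.
  by rewrite -(expansion_der_coord F0 eP _ X0) Xf mul0r rmorph0.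
move/(ddz_eq0 F0); rewrite -ec => /(expansion_inj (e := e)) fE.
have {fE} : pb f = pb (curve_cst C' (e (pb f) 0)) by rewrite cov_cst.
by move/fmorph_inj => ->; rewrite vfield_cst.
Qed.

(** X is a multiple of any nonzero vector field of C, normalized by one value;
    X and X' then agree on C', where both are derivations into the function field
    of C. *)
Lemma inv_form_pullback (P : cpoint C) z (X' : vfield C') : local_coordinate P z ->
  vfield_nonzero X' ->
  let alpha := pullback phi 1 (inv_vfield X') in let X := inv_form alpha in
  [/\ vfield_nonzero X, alpha = inv_vfield X & forall f, pb (X' f) = X (pb f)].
Proof.
move=> zP [t Xt] alpha X.
have : exists w, exists f g, inv_vfield X' = dpow f g 1 /\ w = dpow (pb f) (pb g) 1.
  exists (dpow (pb (X' t)^-1) (pb t) 1), (X' t)^-1, t; split=> //.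
  by apply/funext => Y; rewrite (inv_vfieldE F0 _ Xt) /dpow expr1 mulrC.
move=> /(@xgetPex _ (fun=> 0)) /=; rewrite -/(pullback phi 1 _) -/alpha.
move=> [f [g [fgE aE]]].
have fX' : f * X' g = 1.
  have := congr1 (fun w : differential C' => w X') fgE.
  by rewrite /dpow expr1 (inv_vfieldE F0 _ Xt) divff.
have X'g : X' g != 0 by apply: contra_eq_neq fX' => ->; rewrite mulr0 eq_sym oner_eq0.
have [e eP] := laurent_expansion_ex zP; have [X1 X1z] := vfield_coord_ex F0 eP.
have X10 : vfield_nonzero X1 by exists z; rewrite X1z oner_eq0.
have X1g := vfield_pb_neq0 zP X10 X'g.
have f0 : pb f != 0.
  rewrite fmorph_eq0; apply: contra_eq_neq fX' => ->.
  by rewrite mul0r eq_sym oner_eq0.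
have aX : alpha X = 1.
  have : exists Y, alpha Y = 1.
    exists (VField (scale_vfield_cst (pb f * X1 (pb g))^-1 X1)).
    by rewrite aE /dpow expr1 /=; field; rewrite f0 X1g.
  by move=> /(@xgetPex _ (zero_vfield C) [set Y | alpha Y = 1]).
have Xg : X (pb g) = pb (X' g).
  apply: (mulfI f0); rewrite -rmorphM fX' rmorph1.
  by move: aX; rewrite aE /dpow expr1.
have Xg0 : X (pb g) != 0 by rewrite Xg fmorph_eq0.
split; first by exists (pb g).
  apply/funext => Y; rewrite (inv_vfieldE F0 _ Xg0) aE /dpow expr1 Xg.
  apply: (mulIf Xg0); rewrite Xg divfK ?fmorph_eq0// mulrAC -rmorphM fX'.
  by rewrite rmorph1 mul1r.
move=> h.
have derX' : der_along pb (pb \o X').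
  split=> [x y|x y|c]; rewrite /comp; first by rewrite derD rmorphD.
    by rewrite derM rmorphD !rmorphM.
  by rewrite vfield_cst rmorph0.
have derX : der_along pb (X \o pb).
  split=> [x y|x y|c]; rewrite /comp; first by rewrite rmorphD derD.
    by rewrite rmorphM derM.
  by rewrite cov_cst vfield_cst.
have := der_along_proportional h g F0 derX' derX; rewrite /comp Xg [RHS]mulrC.
by apply: mulIf; rewrite fmorph_eq0.
Qed.

End LiftVectorField.

(** * Finiteness of zeros, poles and ramification *)

Lemma finite_roots (F : fieldType) (r : {poly F}) :
  r != 0 -> finite_set [set c | root r c].
Proof.
move=> r0; apply: contrapT => /(infinite_set_fset (size r))[B Br].
rewrite leqNgt => /negP; apply; apply: max_poly_roots => //.
  by apply/allP => c cB; apply: Br.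
exact: finmap.fset_uniq.
Qed.

Lemma finite_ffun_range (n : nat) (T : choiceType) (x : T) (A : set T) :
  finite_set A -> finite_set [set h : {ffun 'I_n -> T} | forall j, A (h j)].
Proof.
move=> /finite_seqP[s ->].
apply: (sub_finite_set (B := [set [ffun j => nth x s (k j)] |
    k in [set: {ffun 'I_n -> 'I_(size s).+1}]])); last first.
  exact/finite_image/finite_finset.
move=> h hs; exists [ffun j => inord (index (h j) s)] => //.
apply/ffunP => j; rewrite !ffunE inordK ?nth_index//; first exact: hs.
by rewrite ltnS index_size.
Qed.

Lemma mmap_homog_scale (A B : comNzRingType) (e : {rmorphism A -> B}) d n
    (h : 'I_n -> B) c (p : {mpoly A[n]}) : p \is d.-homog ->
  mmap e (fun j => h j * c) p = mmap e h p * c ^+ d.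
Proof.
move=> /dhomogP pd; rewrite /mmap mulr_suml; apply: eq_big_seq => m /pd md.
have {}md : mdeg m = d := md.
rewrite -mulrA; congr (_ * _); rewrite /mmap1 -md mdegE -prodrXr -big_split.
by apply: eq_bigr => j _; rewrite exprMn.
Qed.

Section Points.
Variables (F : fieldType) (C : curve F).
Implicit Types (P Q : cpoint C) (f : C).
Local Notation gen := (@curve_gen F C).

Lemma point_eq (i : 'I_(curve_dim C).+1) P Q : P i != 0 -> Q i != 0 ->
  (forall j, P j / P i = Q j / Q i) -> P = Q.
Proof.
move=> Pi Qi PQ.
have [a Pa Pl] := point_normalized P; have [b Qb Ql] := point_normalized Q.
have PQE j : P j = P i / Q i * Q j.
  by apply: (mulIf (invr_neq0 Pi)); rewrite PQ; field; rewrite Pi Qi.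
have PQ0 : P i / Q i != 0 by rewrite mulf_neq0 ?invr_eq0.
have ab : a = b.
  apply/val_inj/eqP; rewrite eqn_leq; apply/andP; split; rewrite leqNgt; apply/negP.
    move=> /Pl; rewrite PQE Qb mulr1 => /eqP; exact/negP.
  move=> /Ql Qa; have := PQE a; rewrite Pa Qa mulr0 => /eqP.
  by rewrite oner_eq0.
have PQ1 : P i / Q i = 1.
  by have := PQE a; rewrite Pa ab Qb mulr1.
have {}PQE : point_coord P = point_coord Q by apply/ffunP => j; rewrite PQE PQ1 mul1r.
case: P Q PQE {Pi Qi PQ Pa Pl Qb Ql PQ0 PQ1} => p p1 p2 [q q1 q2] /= pq.
by rewrite pq in p1 p2 *; congr CPoint; apply: Prop_irrelevance.
Qed.

Lemma chart_value P (i j : 'I_(curve_dim C).+1) : P i != 0 ->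
  has_value P (gen j / gen i) (P j / P i).
Proof.
move=> Pi; exists 1%N, 'X_j, 'X_i; split.
- by rewrite dhomogX; apply/eqP/mdeg1.
- by rewrite dhomogX; apply/eqP/mdeg1.
- by rewrite mevalXU.
- by rewrite !mmapX !mmap1U.
- by rewrite !mevalXU.
Qed.

Lemma chart_neq0 P (i : 'I_(curve_dim C).+1) : P i != 0 -> gen i != 0.
Proof.
move=> Pi; have := @ev_homog_neq0 _ _ P 1 'X_i.
by rewrite mevalXU mmapX mmap1U; apply=> //; rewrite dhomogX; apply/eqP/mdeg1.
Qed.

Lemma finite_charts (S : set (cpoint C)) :
  (forall i : 'I_(curve_dim C).+1, finite_set (S `&` [set P | P i != 0])) ->
  finite_set S.
Proof.
move=> Sf; apply: (sub_finite_set (B := \bigcup_(i in [set: 'I_(curve_dim C).+1])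
    (S `&` [set P | P i != 0]))).
  move=> P SP; have [i Pi _] := point_normalized P.
  by exists i => //; split=> //=; rewrite Pi oner_eq0.
by apply: bigcup_finite => // i _; apply: Sf.
Qed.

(** At a zero of f, an affine coordinate function y takes as value a root of a
    nonzero polynomial r such that f divides r(y); so there are finitely many
    possible values for each of the coordinates. *)
Lemma finite_zeros f : f != 0 -> finite_set [set P | has_value P f 0].
Proof.
move=> f0; apply: finite_charts => i.
have [r rP] := choice (fun j => function_dvd_poly (gen j / gen i) f0).
have r0 : \prod_j r j != 0 by apply/prodf_neq0 => j _; have [_ [? _]] := rP j.
pose A := [set c | root (\prod_j r j) c].
pose G : set {ffun 'I_(curve_dim C).+1 -> F} :=
  [set h | forall j, A (h j)] `&` [set h | h i = 1].
pose affine P : {ffun 'I_(curve_dim C).+1 -> F} := [ffun j => P j / P i].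
apply: (sub_finite_set (B := affine @^-1` G)).
  move=> P [/= Pf Pi]; split=> /= [j|]; rewrite ffunE ?divff//.
  rewrite /A /= rootE horner_prod (bigD1 j)//=; apply/eqP.
  have [p [_ rE]] := rP j; have yP := chart_value j Pi.
  have := has_value_horner (r j) yP; rewrite rE.
  have : has_value P (f * mmap (curve_cst C) (pair_val f (gen j / gen i)) p)
      (0 * p.@[pair_val 0 (P j / P i)]).
    apply: has_valueM => //; apply: has_value_mmap => k.
    by rewrite /pair_val; case: ifP.
  by rewrite mul0r => h0 /(has_value_uniq h0) <-; rewrite mul0r.
apply: finite_preimage; last first.
  by apply: finite_setIl; apply: finite_ffun_range 0 _ (finite_roots r0).
have Pi0 P : P \in affine @^-1` G -> P i != 0.
  rewrite inE => -[_ /=]; rewrite ffunE => /eqP; apply: contraTneq => ->.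
  by rewrite mul0r eq_sym oner_eq0.
move=> P Q PG QG /ffunP PQ; apply: (@point_eq i); [exact: Pi0|exact: Pi0|].
by move=> j; have := PQ j; rewrite !ffunE.
Qed.

(** A pole of a fraction is a zero of its denominator, dehomogenized in a
    chart. *)
Lemma finite_poles f : finite_set [set P | ~ regular_at P f].
Proof.
have [d [p [q [pd qd q0 fE]]]] := curve_generated f.
apply: finite_charts => i; have [gi0|gi] := eqVneq (gen i) 0.
  apply: (sub_finite_set (B := set0)) => // P [_ /= /chart_neq0].
  by rewrite gi0 eqxx.
have qi0 : mmap (curve_cst C) gen q / gen i ^+ d != 0.
  by rewrite mulf_neq0 ?invr_eq0 ?expf_neq0.
apply: (sub_finite_set _ (finite_zeros qi0)) => P [/= Pf Pi].
have qP : q.@[P] = 0.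
  by apply: contra_notP Pf => /eqP qP; eexists; exists d, p, q; split.
exists d, q, ('X_i ^+ d); split=> //.
- by rewrite -[d in d.-homog]mul1n; apply: dhomogMn; rewrite dhomogX; apply/eqP/mdeg1.
- by rewrite rmorphXn /= mevalXU expf_neq0.
- by rewrite rmorphXn /= mmapX mmap1U.
- by rewrite qP mul0r.
Qed.

(** X z is regular at P as soon as X maps the affine coordinates of a chart at P
    to regular functions: z is a quotient of polynomials in them. *)
Lemma finite_vfield_poles (X : vfield C) (z : cpoint C -> C) :
  (forall P, local_coordinate P (z P)) ->
  finite_set [set P | ~ regular_at P (X (z P))].
Proof.
move=> zP; apply: finite_charts => i.
apply: (sub_finite_set (B := \bigcup_(j in [set: 'I_(curve_dim C).+1])
    [set P | ~ regular_at P (X (gen j / gen i))])); last first.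
  by apply: bigcup_finite => // j _; apply: finite_poles.
move=> P [/= PX Pi]; apply: contrapT => noj; apply: PX.
have Xy j : regular_at P (X (gen j / gen i)).
  by apply: contrapT => nr; apply: noj; exists j.
have gi := chart_neq0 Pi.
have Xpoly (p : {mpoly F[(curve_dim C).+1]}) :
    let y := mmap (curve_cst C) (fun j => gen j / gen i) p in
    regular_at P y /\ regular_at P (X y).
  elim/mpoly_ring_ind: p => [c|j|p q [rp rXp] [rq rXq]|p q [rp rXp] [rq rXq]] y;
    rewrite {}/y.
  - by rewrite mmapC vfield_cst; split; [apply: regular_cst|apply: regular0].
  - rewrite mmapX mmap1U; split=> //; eexists; exact: chart_value.
  - by rewrite rmorphD derD; split; apply: regularD.
  - rewrite rmorphM derM; split; first exact: regularM.
    by apply: regularD; apply: regularM.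
have [d [p [q [pd qd qP zE _]]]] := coord_value0 (zP P).
set y := fun j => gen j / gen i in Xpoly *.
pose a := mmap (curve_cst C) y p; pose b := mmap (curve_cst C) y q.
have q0 := ev_homog_neq0 qd qP.
have aE : a = mmap (curve_cst C) gen p * (gen i)^-1 ^+ d by apply: mmap_homog_scale.
have bE : b = mmap (curve_cst C) gen q * (gen i)^-1 ^+ d by apply: mmap_homog_scale.
have c0 : (gen i)^-1 ^+ d != 0 by rewrite expf_neq0 ?invr_eq0.
have b0 : b != 0 by rewrite bE mulf_neq0.
have {}zE : z P = a / b by rewrite zE aE bE -mulf_div divff// mulr1.
have XzE : X (z P) = (X a - z P * X b) * b^-1.
  have -> : X a = X (z P * b) by rewrite zE divfK.
  by rewrite derM addrK mulfK.
rewrite XzE; apply: regularM.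
  apply: regularB; first by have [] := Xpoly p.
  by apply: regularM; [apply: coord_regular|have [] := Xpoly q].
have bP : has_value P b q.@[fun j => P j / P i].
  by apply: has_value_mmap => j; apply: chart_value.
eexists; apply: (has_valueV _ bP).
have -> : q.@[fun j => P j / P i] = q.@[P] * (P i)^-1 ^+ d.
  exact: (mmap_homog_scale idfun).
by rewrite mulf_neq0// expf_neq0 ?invr_eq0.
Qed.

End Points.
Section Divisors.
Variables (F : fieldType) (C C' : curve F) (phi : covering C C').
Hypothesis F0 : [pchar F] =i pred0.
Local Notation pb := (cov_pb phi).
Variables (X' : vfield C') (X : vfield C).
Hypotheses (X'0 : vfield_nonzero X') (X0 : vfield_nonzero X).
Hypothesis pbX : forall f, pb (X' f) = X (pb f).
Variables (z : cpoint C -> C) (z' : cpoint C' -> C').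
Hypothesis zP : forall P, local_coordinate P (z P).
Hypothesis z'P : forall P', local_coordinate P' (z' P').

Lemma finite_cov_preimage (S : set (cpoint C')) :
  finite_set S -> finite_set [set P | S (phi P)].
Proof.
move=> Sf; apply: (sub_finite_set (B := \bigcup_(P' in S) [set P | phi P = P'])).
  by move=> P /= SP; exists (phi P).
apply: bigcup_finite => // P' _.
have pz : pb (z' P') != 0 by rewrite fmorph_eq0 (coord_neq0 (z'P P')).
apply: (sub_finite_set _ (finite_zeros pz)) => P /= PP'.
by apply: cov_value; rewrite PP'; apply: coord_value0.
Qed.

(** If P is a ramification point and t is regular at phi P, then d(pb t)/dz
    vanishes at P; when X z is regular there, so does pb (X' t) = X (pb t). *)
Lemma finite_ramified : finite_set [set P | ram_index phi P <> 1%N].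
Proof.
have [t Xt] := X'0.
have pXt : pb (X' t) != 0 by rewrite fmorph_eq0.
apply: (sub_finite_set (B := [set P | has_value P (pb (X' t)) 0] `|`
  ([set P | ~ regular_at P (X (z P))] `|` [set P | ~ regular_at (phi P) t]))); last first.
  rewrite !finite_setU; split; first exact: finite_zeros.
  split; first exact: finite_vfield_poles.
  exact: (finite_cov_preimage (finite_poles t)).
move=> P /= ramP; apply: contrapT => nP; apply: ramP.
have [n [u [c [-> uc c0 zE]]]] := ram_indexP (zP P) (z'P (phi P)).
case: n zE => // n zE; exfalso; apply: nP.
have [Xz|] := pselect (regular_at P (X (z P))); last by right; left.
have [[b tb]|] := pselect (regular_at (phi P) t); last by right; right.
left; rewrite pbX.
have : has_value (phi P) (t - curve_cst C' b) 0.
  by rewrite -(subrr b); apply: has_valueB => //; apply: has_value_cst.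
case/(value0_dvd (z'P (phi P))) => g rg gE.
have rug : regular_at P (u * pb g).
  by apply: regularM; [exists c|apply: cov_regular].
have tE : pb t = curve_cst C b + u * pb g * z P ^+ n.+2.
  rewrite -(cov_cst phi) -[t in LHS](subrK (curve_cst C' b)) gE addrC rmorphD rmorphM zE.
  by congr (_ + _); ring.
have Xz0 := vfield_coord_neq0 F0 (zP P) X0.
apply/(zP P); exists (X (u * pb g) / X (z P) * X (z P) * z P ^+ n.+1
    + n.+2%:R * (u * pb g) * z P ^+ n * X (z P)).
  apply: regularD; apply: regularM.
  - apply: regularM => //; exact: der_coord_regular.
  - exact/regularX/coord_regular.
  - apply: regularM; last exact/regularX/coord_regular.
    by apply: regularM => //; apply: regular_nat.
  - exact: Xz.
rewrite divfK// tE derD vfield_cst add0r derM derX !exprS; ring.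
Qed.

Lemma pullback_div_divisor (D' : cpoint C' -> int) :
  is_divisor D' -> is_divisor (pullback_div phi D').
Proof.
move=> D'f; apply: (sub_finite_set (B := [set P | ram_index phi P <> 1%N] `|`
  [set P | D' (phi P) != 0])).
  move=> P /=; rewrite /pullback_div; apply: contra_neqP => /not_orP[/contrapT r1].
  by move=> /negP/negPn/eqP D'0; rewrite D'0 r1.
by rewrite finite_setU; split; [exact: finite_ramified|exact: (finite_cov_preimage D'f)].
Qed.

End Divisors.

(** * Functoriality of the quantized algebras *)

Lemma pchar0_complex (R : realType) : [pchar (complex R)] =i pred0.
Proof. exact: pchar_num. Qed.

Theorem proposition2p1 (R : realType) (C C' : curve (complex R))
  (smoothC : smooth C) (smoothC' : smooth C')
  (g g' : nat) (genusC : has_genus C g) (genusC' : has_genus C' g')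
  (g_gt1 : (1 < g)%N) (g'_gt1 : (1 < g')%N)
  (phi : covering C C')
  (X' : vfield C') (X'_neq0 : vfield_nonzero X')
  (alpha' : differential C') (alpha'E : alpha' = inv_vfield X')
  (alpha : differential C) (alphaE : alpha = pullback phi 1 alpha')
  (X : vfield C) (XE : X = inv_form alpha)
  (D' : cpoint C' -> int) (divD' : is_divisor D') (effD' : effective D')
  (D : cpoint C -> int) (DE : D = pullback_div phi D')
  (z : cpoint C -> C) (zP : forall P, local_coordinate P (z P))
  (z' : cpoint C' -> C') (z'P : forall P', local_coordinate P' (z' P')) :
  [/\ vfield_nonzero X /\ alpha = inv_vfield X,
      is_divisor D,
      effective D <-> (forall P, (1 < ram_index phi P)%N -> 0 < D' (phi P))
    & exists phi_rat : psido X' -> psido X,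
      [/\ filtered_morphism (Brat X') (Brat X) phi_rat,
          filtered_morphism (Bdiv z' (zero_div C')) (Bdiv z (zero_div C)) phi_rat
          /\ quantizes phi (Bdiv z' (zero_div C')) (zero_div C') (zero_div C)
               phi_rat
        & effective D ->
          filtered_morphism (Bdiv z' D') (Bdiv z D) phi_rat
          /\ quantizes phi (Bdiv z' D') D' D phi_rat]].
Proof.
have F0 := @pchar0_complex R; have [P0 _] := genus_point genusC.
have [X0 alphaX pbX] : [/\ vfield_nonzero X, alpha = inv_vfield X
    & forall f, cov_pb phi (X' f) = X (cov_pb phi f)].
  by rewrite XE alphaE alpha'E; apply: (inv_form_pullback _ F0 (zP P0)).
have ram_gt0 P : (0 < ram_index phi P)%N.
  by have [n [u [c [-> _ _ _]]]] := ram_indexP (zP P) (z'P (phi P)).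
pose phi_rat : psido X' -> psido X := psido_map (cov_pb phi) X.
have morph (E' : cpoint C' -> int) (E : cpoint C -> int) : effective E ->
    (forall P, pullback_div phi E' P <= E P) ->
    filtered_morphism (Bdiv z' E') (Bdiv z E) phi_rat
    /\ quantizes phi (Bdiv z' E') E' E phi_rat.
  move=> E0 leE; split.
    apply: (filtered_morphism_restrict pbX) => a.
    exact: (pullback_Bdiv F0 X'_neq0 X0 pbX zP z'P E0 leE).
  move=> i; split=> [w|a aB ai].
    exact: (pullback_H0 F0 X0 pbX z'P leE).
  split; last exact: pullback_symb.
  exact: (symb_H0 F0 z'P X'_neq0 aB ai).
split.
- by [].
- rewrite DE; exact: (pullback_div_divisor F0 X'_neq0 X0 pbX zP z'P divD').
- rewrite DE /pullback_div; split=> [effD P ram_gt1|pos P].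
    have := effD P; have := effD' (phi P); nia.
  have := effD' (phi P); have := ram_gt0 P.
  have [/pos|] := ltP 1%N (ram_index phi P); nia.
exists phi_rat; split.
- apply: (filtered_morphism_restrict pbX) => a; exact: psido_map_order.
(* The pull-back of the zero divisor has multiplicities 1 - nu <= 0. *)
- apply: morph => // P; rewrite /pullback_div /zero_div mul0r add0r.
  by have := ram_gt0 P; lia.
- by move=> effD; apply: morph => // P; rewrite DE.
Qed.
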